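(* For every positive integer $n$, \[ \mathrm{sat}_4(n,B_4)= \begin{cases} \binom{n}{4} & \text{if } n\leq 6,\\ n & \text{if } n \in \{7,8\},\\ n-3 & \text{if } n\geq 9. \end{cases} \]
   Context: A $4$-uniform hypergraph $H$ has a vertex set $V(H)$ and a set $E(H)$ of $4$-element subsets of $V(H)$ (hyperedges). The bow tie $B_4$ is the $4$-uniform hypergraph with $7$ vertices and two hyperedges sharing exactly one vertex; a $4$-uniform hypergraph is $B_4$-free iff no two of its hyperedges intersect in exactly one vertex. A $4$-uniform hypergraph $H$ is $B_4$-saturated if it is $B_4$-free and for every $4$-subset $e\subseteq V(H)$ with $e\notin E(H)$ there is a hyperedge $f\in E(H)$ with $|e\cap f|=1$ (so adding $e$ creates a copy of $B_4$). $\mathrm{sat}_4(n,B_4)$ is the minimum number of hyperedges of a $B_4$-saturated $4$-uniform hypergraph on $n$ vertices. *)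

(* Defs.v *)
From mathcomp Require Import all_boot.
Set Implicit Arguments. Unset Strict Implicit. Unset Printing Implicit Defensive.

Definition uniform4 (n : nat) (H : {set {set 'I_n}}) : bool :=
  [forall e in H, #|e| == 4].

Definition B4_free (n : nat) (H : {set {set 'I_n}}) : bool :=
  [forall e in H, forall f in H, #|e :&: f| != 1].

Definition B4_saturated (n : nat) (H : {set {set 'I_n}}) : bool :=
  [&& uniform4 H, B4_free H &
      [forall e : {set 'I_n}, (#|e| == 4) && (e \notin H) ==>
                              [exists f in H, #|e :&: f| == 1]]].

Definition is_sat4_B4 (n m : nat) : Prop :=
  (exists H : {set {set 'I_n}}, B4_saturated H /\ #|H| = m) /\
  (forall H : {set {set 'I_n}}, B4_saturated H -> m <= #|H|).

(* Main.v *)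
Require Import Defs.
From mathcomp Require Import all_boot.
From mathcomp Require Import zify.
Set Implicit Arguments. Unset Strict Implicit. Unset Printing Implicit Defensive.

(** Call two vertices twins if they lie in the same edges of a saturated
    hypergraph H.  The lower bound n - 3 comes from minimising
    [|Z ∪ V(F)| - |F|] over subfamilies F of H, where Z collects the isolated
    vertices and either all twins or two disjoint pairs of twins (whose union is
    then an edge).  For a largest minimiser F, new edges always bring in more new
    vertices than there are new edges; playing this against saturation shows that
    an edge outside F cannot meet X = Z ∪ V(F), neither in a pair of twins nor in
    any other pair.  The edges outside F then form a saturated hypergraph without
    twins, and a finite case analysis finds in any such hypergraph a nonempty
    subfamily with at least as many edges as vertices, so F = H.  The starting
    value of the minimised quantity is at most 3; the one delicate case has two
    pairs of twins and an isolated vertex.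

    For n >= 10, n <> 11 equality is attained by two pairs P, Q and two triples
    R, S, with edges P ∪ Q, P together with a pair of R, Q together with a pair
    of S, and R plus any remaining vertex. *)

(** Twins are the obstacle. A nonempty saturated family without twins has a nonempty subfamily with
    at least as many edges as vertices; with twins this already fails for a single edge, which is
    saturated on its own four vertices. So twins are absorbed into [Z] at the start, and the price
    is the constant 3. If no two twin pairs are disjoint, at most three vertices are twins or
    isolated, and the empty family serves as the start. Otherwise the union of two disjoint pairs is
    an edge, and four vertices minus one edge is again 3. An isolated vertex would raise this to 4,
    so in that case a denser starting family is needed, with at most two more vertices than edges.
    Choosing a largest minimiser makes the inequality for new edges strict: [k] new edges on [k] new
    vertices are already contradictory, and the local arguments end by exhibiting such a
    configuration. *)

Lemma card_setsI_count (T : finType) (l : seq T) (f : {set T}) :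
  uniq l -> #|[set:: l] :&: f| = count (mem f) l.
Proof.
move=> ul; rewrite -size_filter -(card_uniqP (filter_uniq _ ul)).
by apply: eq_card => x; rewrite !inE mem_filter andbC.
Qed.

Lemma card_sets_uniq (T : finType) (l : seq T) : uniq l -> #|[set:: l]| = size l.
Proof. by move=> /card_uniqP <-; apply: eq_card => x; rewrite inE. Qed.

Lemma eq_sets_map (I : eqType) (T : finType) (g h : I -> T) (l : seq I) :
  {in l, g =1 h} -> [set:: map g l] = [set:: map h l].
Proof. by move=> /eq_in_map ->. Qed.

(** On [iota 0 k] this enumerates the subsets of size at most [m] as increasing lists, without
    generating the larger ones. *)
Fixpoint bounded_subseqs (m : nat) (l : seq nat) : seq (seq nat) :=
  if l is x :: l' then
    (if m is m'.+1 then [seq x :: c | c <- bounded_subseqs m' l'] else [::])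
      ++ bounded_subseqs m l'
  else [:: [::]].

Lemma mem_bounded_subseqs m l c :
  subseq c l -> size c <= m -> c \in bounded_subseqs m l.
Proof.
elim: l m c => [|x l IH] m [|y c] //= sub szc.
- by rewrite mem_cat IH ?sub0seq ?orbT.
- rewrite mem_cat; case: m => // m in szc *; move: sub.
  case: eqP => [->|_] sub; last by rewrite IH ?orbT.
  by apply/orP; left; apply/map_f/IH.
Qed.

(** * Certified case analysis *)

(* [(k, F)] stands for [k] distinct vertices, numbered from 0, among which the
   4-sets listed in [F] are known to be edges. *)
Definition state := (nat * seq (seq nat))%type.

(* [Sat g]: either [g] is an edge or some edge meets it in one vertex.
   [Sep i j]: some edge contains exactly one of [i] and [j]. *)
Inductive choice := Sat of seq nat | Sep of nat & nat.

Definition edge_code (k : nat) (e : seq nat) :=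
  [&& size e == 4, uniq e & all (ltn^~ k) e].

Definition selects (ch : choice) (c : seq nat) :=
  match ch with
  | Sat g => count (mem c) g == 1
  | Sep i j => (i \in c) != (j \in c)
  end.

(** [sep] disables [Sep] in searches over hypergraphs that may have twins. *)
Definition valid_choice (sep : bool) (k : nat) (ch : choice) :=
  match ch with
  | Sat g => edge_code k g
  | Sep i j => [&& sep, i < k, j < k & i != j]
  end.

(* The trace [c] of the new edge on the known vertices is enumerated; its other
   vertices receive the numbers [k], [k + 1], ... *)
Definition branches (bnd : pred nat) (st : state) (ch : choice) : seq state :=
  let: (k, F) := st in
  (if ch is Sat g then [:: (k, rcons F g)] else [::]) ++
  [seq (k + (4 - size c), rcons F (c ++ iota k (4 - size c)))
     | c <- bounded_subseqs 4 (iota 0 k)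
     & [&& selects ch c, all (fun h => count (mem c) h != 1) F
         & bnd (k + (4 - size c))]].

(** Refutation is monotone: a state containing a relabelled copy of a refuted state is refuted.
    Entry [i] of [p] is the image of vertex [i] of [st0]. *)
Definition subsumes (p : seq nat) (st0 st : state) :=
  [&& size p == st0.1, uniq p, all (ltn^~ st.1) p,
      all (edge_code st0.1) st0.2
    & all (fun e => has (perm_eq [seq nth 0 p i | i <- e]) st.2) st0.2].

(** Sorting makes distinct codes stand for distinct 4-sets, so that [size] really counts edges. *)
Definition closed_state (thr : nat -> nat) (st : state) :=
  [&& 0 < size st.2, thr st.1 <= size st.2 & uniq [seq sort leq e | e <- st.2]].

(* A hint [(j, p)] claims that [p] embeds the [j]-th state of the certificate,
   which was refuted before, into one of the branches. *)
Definition cert_node := (state * choice * seq (nat * seq nat))%type.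

Definition node_ok bnd sep thr (solved : seq state) (nd : cert_node) :=
  let: (st, ch, hints) := nd in
  valid_choice sep st.1 ch &&
  all (fun st' => closed_state thr st' ||
         has (fun h => (h.1 < size solved)
                && subsumes h.2 (nth (0, [::]) solved h.1) st') hints)
      (branches bnd st ch).

(** Hints point back into [solved], so no refutation is circular; the deepest states come first and
    the root comes last. *)
Fixpoint cert_ok bnd sep thr (solved : seq state) (cert : seq cert_node) :=
  if cert is nd :: cert' then
    node_ok bnd sep thr solved nd &&
    cert_ok bnd sep thr (rcons solved nd.1.1) cert'
  else true.

(** * Soundness of the certificate checker *)

Section Search.
Variables (T : finType) (x0 : T).

Definition decode (s : seq T) (e : seq nat) : {set T} :=
  [set:: [seq nth x0 s i | i <- e]].

Lemma decode_uniq (s : seq T) (e : seq nat) :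
  uniq s -> uniq e -> all (ltn^~ (size s)) e -> uniq [seq nth x0 s i | i <- e].
Proof.
move=> us ue /allP lte; rewrite map_inj_in_uniq // => i j ie je /eqP.
have [/= lti ltj] := (lte i ie, lte j je).
by rewrite nth_uniq // => /eqP.
Qed.

Lemma card_decodeI (s : seq T) e (f : {set T}) :
  uniq s -> edge_code (size s) e ->
  #|decode s e :&: f| = count (fun i => nth x0 s i \in f) e.
Proof.
move=> us /and3P[_ ue lte].
by rewrite card_setsI_count ?decode_uniq // count_map.
Qed.

Lemma card_decode_family (s : seq T) (F : seq (seq nat)) :
  uniq s -> all (edge_code (size s)) F -> uniq [seq sort leq e | e <- F] ->
  #|[set:: [seq decode s e | e <- F]]| = size F.
Proof.
move=> us /allP codeF uF; rewrite card_sets_uniq ?size_map //.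
rewrite map_inj_in_uniq ?(map_uniq uF) // => e e' eF e'F eq_dec.
have [/and3P[_ ue /allP lte] /and3P[_ ue' /allP lte']] := (codeF _ eF, codeF _ e'F).
have sub (a b : seq nat) : uniq a -> {in a, forall i, i < size s} ->
    {in b, forall i, i < size s} -> decode s a = decode s b -> {subset a <= b}.
  move=> ua la lb eq_ab i ia; have lti := la i ia.
  have: nth x0 s i \in decode s b by rewrite -eq_ab inE map_f.
  rewrite inE => /mapP[j jb /eqP]; have ltj := lb j jb.
  by rewrite nth_uniq // => /eqP->.
have perm: perm_eq e e'.
  apply: uniq_perm => // i; apply/idP/idP; apply: sub => //.
suff /(_ _ _ eF e'F) inj: {in F &, injective (sort leq)}.
  by apply: inj; apply/perm_sortP => //; [apply: leq_total|apply: leq_trans|apply: anti_leq].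
move=> a b aF bF eq_ab; apply/eqP; move/eqP: eq_ab.
have := uF; move/(uniqP [::]) => inj /eqP eq_ab.
have ia : index a F < size F by rewrite index_mem.
have ib : index b F < size F by rewrite index_mem.
have: index a F = index b F.
  apply: inj; rewrite ?inE ?size_map //.
  by rewrite !(nth_map [::]) ?nth_index.
by move=> eq_i; rewrite -(nth_index [::] aF) eq_i nth_index.
Qed.

Variables (E : {set {set T}}) (D : {set T}) (bnd : pred nat) (sep : bool).
Variables (thr : nat -> nat) (Goal : Prop).

Definition realized (s : seq T) (F : seq (seq nat)) :=
  [/\ uniq s, {subset s <= D}, all (edge_code (size s)) F
    & {in F, forall e, decode s e \in E}].

Hypothesis E_card : {in E, forall f : {set T}, #|f| = 4}.
Hypothesis E_sub : {in E, forall f : {set T}, f \subset D}.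
Hypothesis E_free : {in E &, forall f g : {set T}, #|f :&: g| != 1}.
Hypothesis E_sat : forall g : {set T}, g \subset D -> #|g| = 4 -> g \notin E ->
  exists2 f, f \in E & #|g :&: f| = 1.
Hypothesis E_sep : sep -> {in D &, forall u v, u != v ->
  exists2 f : {set T}, f \in E & (u \in f) != (v \in f)}.
Hypothesis D_bnd : forall s, uniq s -> {subset s <= D} -> bnd (size s).
Hypothesis goalP : forall s F, realized s F -> closed_state thr (size s, F) -> Goal.

(** [Goal] stays abstract because the same search yields a dense subfamily in one application and a
    lower bound on the number of edges in the others. *)
Definition refuted (st : state) := forall s, size s = st.1 -> realized s st.2 -> Goal.

Lemma refuted_closed st : closed_state thr st -> refuted st.
Proof. by case: st => k F cl s szs rs; apply: goalP rs _; rewrite szs. Qed.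

Lemma refuted_subsumes p st0 st : refuted st0 -> subsumes p st0 st -> refuted st.
Proof.
case: st0 st => [k0 F0] [k F] /= ref0 /and5P[/eqP szp up /allP ltp code0 sub] s /= szs.
move=> [us sD codeF sE]; have ltps i : i \in p -> i < size s by rewrite szs; apply: ltp.
apply: (ref0 [seq nth x0 s i | i <- p]); first by rewrite size_map.
split; rewrite ?size_map ?szp //.
- by rewrite decode_uniq //; apply/allP.
- by move=> x /mapP[i ip ->]; apply/sD/mem_nth/ltps.
move=> e eF0; have /hasP[e' e'F perm] := allP sub _ eF0.
have -> : decode [seq nth x0 s i | i <- p] e = decode s e'; last exact: sE.
have /and3P[_ _ /allP lte] := allP code0 _ eF0.
have -> : decode [seq nth x0 s i | i <- p] e = decode s [seq nth 0 p i | i <- e].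
  rewrite /decode -[in RHS]map_comp; apply: eq_sets_map => i ie /=.
  by rewrite (nth_map 0) // szp; apply: lte.
by apply/setP => x; rewrite !inE (perm_mem (perm_map _ perm)).
Qed.

(** Saturation or separation supplies either the edge [g] itself or an edge [f] selected by the
    choice. The trace of [f] on [s] is one of the enumerated subsequences, and [s] extended by the
    remaining vertices of [f] realizes the corresponding branch. *)
Lemma refuted_branches st ch :
  valid_choice sep st.1 ch ->
  (forall st', st' \in branches bnd st ch -> refuted st') -> refuted st.
Proof.
case: st => k F /= valid ref s /= szs [us sD codeF sE].
have addg g : edge_code k g -> decode s g \in E -> ch = Sat g -> Goal.
  move=> codeg gE eq_ch; apply: (ref (k, rcons F g) _ s) => //.
    by rewrite eq_ch mem_cat inE eqxx.
  split; rewrite ?all_rcons ?szs ?codeg -?szs //.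
  by move=> e; rewrite mem_rcons inE => /predU1P[->|/sE].
have addf f : f \in E ->
    selects ch [seq i <- iota 0 k | nth x0 s i \in f] -> Goal.
  move=> fE; set c := filter _ _ => sel.
  have memc i : i < k -> (i \in c) = (nth x0 s i \in f).
    by move=> ltik; rewrite /c mem_filter mem_iota /= add0n ltik andbT.
  have eq_c : [seq nth x0 s i | i <- c] = [seq x <- s | x \in f].
    by rewrite /c -[in RHS](mkseq_nth x0 s) filter_map szs.
  pose R := enum (f :\: [set:: s]).
  have szR : size c + size R = 4.
    rewrite -(size_map (nth x0 s) c) eq_c -(E_card fE) -(cardsID [set:: s] f) -cardE.
    by rewrite setIC card_setsI_count // size_filter.
  have lec4 : size c <= 4 by rewrite -szR leq_addr.
  have szR' : size R = 4 - size c by rewrite -szR addKn.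
  have uc : uniq c by rewrite filter_uniq ?iota_uniq.
  have ltc : all (ltn^~ k) c.
    by apply/allP => i; rewrite /c mem_filter mem_iota => /and3P[].
  have us' : uniq (s ++ R).
    rewrite cat_uniq us enum_uniq andbT /=; apply/hasPn => x.
    by rewrite mem_enum !inE => /andP[].
  have sD' : {subset s ++ R <= D}.
    move=> x; rewrite mem_cat => /orP[/sD //|].
    by rewrite mem_enum inE => /andP[_ /(subsetP (E_sub fE))].
  have szs' : size (s ++ R) = k + (4 - size c) by rewrite size_cat szs szR'.
  have code' : edge_code (size (s ++ R)) (c ++ iota k (4 - size c)).
    rewrite szs'; apply/and3P; split.
    - by rewrite size_cat size_iota subnKC.
    - rewrite cat_uniq uc iota_uniq andbT /=; apply/hasPn => i.
      rewrite mem_iota => /andP[leki _]; apply: contraL leki => /(allP ltc) /=.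
      by rewrite ltnNge.
    rewrite all_cat; apply/andP; split; apply/allP => i.
      by move/(allP ltc) => /= ltik; apply: ltn_addr.
    by rewrite mem_iota => /andP[].
  have dec' : decode (s ++ R) (c ++ iota k (4 - size c)) = f.
    apply/setP => x; rewrite inE map_cat mem_cat.
    have -> : [seq nth x0 (s ++ R) i | i <- c] = [seq x <- s | x \in f].
      rewrite -eq_c; apply/eq_in_map => i /(allP ltc) /= ltik.
      by rewrite nth_cat szs ltik.
    have -> : [seq nth x0 (s ++ R) i | i <- iota k (4 - size c)] = R.
      rewrite -szR' -[RHS](mkseq_nth x0) /mkseq -[k]addn0 iotaDl -map_comp.
      by apply: eq_map => i /=; rewrite nth_cat szs ltnNge leq_addr /= addKn.
    by rewrite mem_filter mem_enum !inE; case: (x \in f); case: (x \in s).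
  apply: (ref (k + (4 - size c), rcons F (c ++ iota k (4 - size c))) _ (s ++ R)) => //.
    rewrite mem_cat; apply/orP; right.
    apply/mapP; exists c => //; rewrite mem_filter sel -szs' D_bnd //.
    rewrite mem_bounded_subseqs ?filter_subseq // !andbT.
    apply/allP => h hF; have codeh := allP codeF _ hF.
    have := E_free (sE _ hF) fE; rewrite card_decodeI //.
    congr (_ != _); apply: eq_in_count => i ih /=; rewrite memc //.
    by case/and3P: codeh => _ _ /allP /(_ _ ih); rewrite szs.
  have dec_old h : h \in F -> decode (s ++ R) h = decode s h.
    move=> hF; apply: eq_sets_map => i ih.
    by case/and3P: (allP codeF _ hF) => _ _ /allP /(_ _ ih) /= lti; rewrite nth_cat lti.
  split=> //.
    rewrite all_rcons code'; apply: sub_all codeF => h /and3P[szh uh /allP lth].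
    apply/and3P; split=> //; apply/allP => i /lth /= lti.
    by rewrite size_cat ltn_addr.
  by move=> e; rewrite mem_rcons inE => /predU1P[->|eF]; rewrite ?dec' // dec_old ?sE.
case: ch valid ref addg addf => [g|i j] /= valid ref addg addf.
  have [gE|gE] := boolP (decode s g \in E); first exact: addg gE _.
  have codeg : edge_code (size s) g by rewrite szs.
  have /and3P[szg ug ltg] := codeg.
  have gD : decode s g \subset D.
    by apply/subsetP => x; rewrite inE => /mapP[i /(allP ltg) lti ->]; apply/sD/mem_nth.
  have cg : #|decode s g| = 4 by rewrite card_sets_uniq ?decode_uniq // size_map; apply/eqP.
  have [f fE] := E_sat gD cg gE; rewrite card_decodeI // => eq1.
  apply: (addf f) => //; rewrite -eq1; apply/eqP; apply: eq_in_count => i /(allP ltg) /=.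
  by rewrite szs => lti; rewrite mem_filter mem_iota /= add0n lti andbT.
case/and4P: valid => hsep ltik ltjk neij.
have iD : nth x0 s i \in D by apply/sD/mem_nth; rewrite szs.
have jD : nth x0 s j \in D by apply/sD/mem_nth; rewrite szs.
have [|f fE sepf] := E_sep hsep iD jD; first by rewrite nth_uniq ?szs.
by apply: (addf f) => //; rewrite !mem_filter !mem_iota /= !add0n ltik ltjk !andbT.
Qed.

Lemma cert_ok_refuted solved cert :
  (forall st, st \in solved -> refuted st) -> cert_ok bnd sep thr solved cert ->
  forall st, st \in [seq nd.1.1 | nd <- cert] -> refuted st.
Proof.
elim: cert solved => [|[[st ch] hints] cert IH] solved //= ref /andP[/andP[valid ok] okc].
have refst : refuted st.
  apply: refuted_branches valid _ => st' /(allP ok) /orP[|/hasP[[j p] _ /=]].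
    exact: refuted_closed.
  by case/andP=> ltj; apply: refuted_subsumes; apply/ref/mem_nth.
move=> st'; rewrite inE => /predU1P[->//|]; apply: IH okc _ => st''.
by rewrite mem_rcons inE => /predU1P[->|/ref].
Qed.

End Search.

(** * Saturated families without twins *)

Notation quad a b c d := [set:: [:: a; b; c; d]].

Ltac bool_cases f := do ![case: (_ \in f) => //].

(* A depth-first search from a single edge, up to isomorphism; every branch ends
   with as many edges as vertices. *)
Definition twin_free_cert : seq cert_node := [::
  (7, [:: [:: 1; 2; 4; 5]; [:: 1; 3; 4; 6]; [:: 2; 3; 5; 6]; [:: 0; 4; 5; 6];
  [:: 2; 4; 5; 6]; [:: 3; 4; 5; 6]], Sat [:: 1; 4; 5; 6], [::]);
  (8, [:: [:: 0; 3; 4; 5]; [:: 1; 4; 5; 6]; [:: 2; 4; 5; 7]; [:: 1; 2; 6; 7];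
  [:: 3; 4; 6; 7]; [:: 3; 5; 6; 7]; [:: 4; 5; 6; 7]], Sat [:: 1; 4; 5; 7],
  [::]);
  (8, [:: [:: 2; 3; 5; 6]; [:: 0; 1; 4; 7]; [:: 3; 4; 5; 7]; [:: 0; 3; 6; 7];
  [:: 2; 4; 6; 7]; [:: 1; 5; 6; 7]; [:: 4; 5; 6; 7]], Sat [:: 0; 4; 5; 6],
  [::]);
  (8, [:: [:: 2; 3; 5; 6]; [:: 0; 1; 4; 7]; [:: 2; 4; 5; 7]; [:: 3; 4; 6; 7];
  [:: 1; 5; 6; 7]; [:: 4; 5; 6; 7]], Sat [:: 1; 4; 5; 6], [:: (1, [:: 0; 2; 3;
  1; 4; 7; 5; 6]); (2, [:: 0; 1; 3; 2; 4; 5; 6; 7]); (2, [:: 0; 1; 2; 3; 4; 6;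
  5; 7])]);
  (7, [:: [:: 2; 3; 4; 5]; [:: 0; 2; 3; 6]; [:: 1; 2; 4; 6]; [:: 1; 3; 5; 6];
  [:: 0; 4; 5; 6]; [:: 3; 4; 5; 6]], Sat [:: 0; 1; 3; 4], [::]);
  (7, [:: [:: 1; 2; 4; 5]; [:: 1; 3; 4; 6]; [:: 2; 3; 5; 6]; [:: 0; 4; 5; 6];
  [:: 3; 4; 5; 6]], Sat [:: 1; 4; 5; 6], [:: (0, [:: 0; 2; 1; 3; 5; 4; 6]);
  (3, [:: 7; 0; 1; 2; 3; 4; 5; 6]); (4, [:: 0; 1; 2; 3; 5; 6; 4])]);
  (8, [:: [:: 0; 2; 4; 6]; [:: 3; 4; 5; 6]; [:: 1; 3; 5; 7]; [:: 2; 4; 5; 7];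
  [:: 2; 3; 6; 7]; [:: 1; 4; 6; 7]; [:: 0; 5; 6; 7]], Sat [:: 0; 3; 4; 7],
  [::]);
  (8, [:: [:: 0; 1; 5; 6]; [:: 3; 4; 5; 6]; [:: 2; 3; 4; 7]; [:: 0; 4; 5; 7];
  [:: 1; 4; 6; 7]; [:: 2; 5; 6; 7]; [:: 3; 5; 6; 7]], Sat [:: 0; 3; 6; 7],
  [::]);
  (8, [:: [:: 0; 1; 4; 5]; [:: 2; 4; 5; 6]; [:: 3; 4; 5; 7]; [:: 2; 3; 6; 7];
  [:: 0; 4; 6; 7]; [:: 1; 5; 6; 7]], Sat [:: 0; 2; 5; 7], [:: (6, [:: 1; 3; 0;
  2; 4; 6; 5; 7]); (7, [:: 2; 3; 0; 1; 5; 6; 7; 4]); (7, [:: 0; 1; 2; 3; 7; 4;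
  5; 6])]);
  (9, [:: [:: 2; 3; 5; 6]; [:: 4; 5; 6; 7]; [:: 4; 5; 6; 8]; [:: 0; 4; 7; 8];
  [:: 1; 4; 7; 8]; [:: 2; 5; 7; 8]; [:: 3; 6; 7; 8]], Sat [:: 5; 6; 7; 8], [::
  (1, [:: 0; 2; 3; 4; 7; 8; 5; 6])]);
  (9, [:: [:: 2; 3; 4; 5]; [:: 4; 5; 6; 7]; [:: 2; 4; 6; 8]; [:: 3; 5; 6; 8];
  [:: 3; 4; 7; 8]; [:: 2; 5; 7; 8]; [:: 0; 6; 7; 8]; [:: 1; 6; 7; 8]], Sat [::
  4; 5; 6; 8], [::]);
  (9, [:: [:: 2; 3; 5; 6]; [:: 2; 4; 5; 8]; [:: 3; 4; 6; 8]; [:: 0; 4; 7; 8];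
  [:: 1; 4; 7; 8]; [:: 3; 5; 7; 8]; [:: 2; 6; 7; 8]; [:: 5; 6; 7; 8]], Sat [::
  4; 5; 6; 7], [::]);
  (9, [:: [:: 2; 3; 4; 5]; [:: 2; 3; 6; 8]; [:: 4; 5; 6; 8]; [:: 2; 4; 7; 8];
  [:: 3; 5; 7; 8]; [:: 0; 6; 7; 8]; [:: 1; 6; 7; 8]], Sat [:: 2; 5; 6; 7], [::
  (10, [:: 0; 1; 3; 4; 2; 5; 6; 7; 8]); (11, [:: 0; 1; 2; 5; 7; 4; 3; 6; 8]);
  (11, [:: 0; 1; 2; 5; 6; 3; 4; 7; 8])]);
  (9, [:: [:: 2; 3; 5; 6]; [:: 4; 5; 6; 8]; [:: 0; 4; 7; 8]; [:: 1; 4; 7; 8];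
  [:: 2; 5; 7; 8]; [:: 3; 6; 7; 8]], Sat [:: 4; 5; 6; 7], [:: (9, [:: 0; 1; 2;
  3; 4; 5; 6; 7; 8]); (12, [:: 0; 1; 2; 3; 5; 6; 4; 7; 8])]);
  (8, [:: [:: 0; 3; 4; 6]; [:: 2; 3; 5; 6]; [:: 1; 2; 5; 7]; [:: 3; 4; 5; 7];
  [:: 1; 3; 6; 7]; [:: 2; 4; 6; 7]; [:: 4; 5; 6; 7]], Sat [:: 1; 4; 5; 6],
  [::]);
  (8, [:: [:: 1; 4; 5; 6]; [:: 0; 2; 3; 7]; [:: 2; 4; 5; 7]; [:: 1; 2; 6; 7];
  [:: 3; 4; 6; 7]; [:: 0; 5; 6; 7]; [:: 3; 5; 6; 7]], Sat [:: 2; 3; 5; 6],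
  [::]);
  (8, [:: [:: 2; 3; 5; 6]; [:: 0; 1; 4; 7]; [:: 1; 2; 5; 7]; [:: 3; 4; 5; 7];
  [:: 1; 3; 6; 7]; [:: 2; 4; 6; 7]; [:: 4; 5; 6; 7]], Sat [:: 1; 4; 5; 6],
  [::]);
  (8, [:: [:: 1; 4; 5; 6]; [:: 0; 2; 3; 7]; [:: 2; 4; 5; 7]; [:: 1; 2; 6; 7];
  [:: 3; 4; 6; 7]; [:: 3; 5; 6; 7]], Sat [:: 2; 3; 4; 6], [:: (14, [:: 0; 1;
  5; 2; 3; 4; 7; 6]); (15, [:: 0; 1; 2; 3; 4; 5; 6; 7]); (16, [:: 0; 2; 1; 4;
  3; 6; 5; 7])]);
  (8, [:: [:: 2; 3; 5; 6]; [:: 0; 1; 4; 7]; [:: 2; 4; 5; 7]; [:: 3; 4; 6; 7];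
  [:: 1; 5; 6; 7]], Sat [:: 0; 4; 5; 6], [:: (8, [:: 0; 1; 2; 3; 4; 7; 5; 6]);
  (13, [:: 0; 8; 2; 3; 1; 5; 6; 4; 7]); (17, [:: 0; 3; 4; 1; 2; 5; 6; 7]);
  (17, [:: 0; 2; 4; 1; 3; 6; 5; 7])]);
  (9, [:: [:: 0; 3; 4; 5]; [:: 4; 5; 6; 7]; [:: 3; 4; 6; 8]; [:: 4; 5; 6; 8];
  [:: 3; 5; 7; 8]; [:: 4; 5; 7; 8]; [:: 1; 6; 7; 8]; [:: 2; 6; 7; 8]], Sat [::
  3; 4; 6; 7], [::]);
  (9, [:: [:: 0; 3; 4; 5]; [:: 3; 4; 6; 7]; [:: 4; 5; 6; 8]; [:: 3; 5; 7; 8];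
  [:: 4; 5; 7; 8]; [:: 1; 6; 7; 8]; [:: 2; 6; 7; 8]], Sat [:: 4; 5; 6; 7], [::
  (19, [:: 0; 1; 2; 3; 4; 5; 6; 8; 7])]);
  (9, [:: [:: 0; 3; 4; 5]; [:: 3; 4; 6; 7]; [:: 3; 5; 6; 8]; [:: 4; 5; 7; 8];
  [:: 1; 6; 7; 8]; [:: 2; 6; 7; 8]], Sat [:: 3; 4; 6; 8], [:: (20, [:: 0; 1;
  2; 5; 4; 3; 7; 8; 6]); (13, [:: 1; 2; 0; 3; 8; 5; 4; 6; 7])]);
  (8, [:: [:: 2; 3; 4; 5]; [:: 0; 2; 3; 6]; [:: 1; 4; 5; 7]; [:: 2; 4; 6; 7];
  [:: 3; 4; 6; 7]; [:: 2; 5; 6; 7]; [:: 3; 5; 6; 7]], Sat [:: 2; 3; 4; 7],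
  [::]);
  (8, [:: [:: 2; 3; 4; 5]; [:: 0; 2; 4; 6]; [:: 1; 3; 5; 7]; [:: 3; 4; 6; 7];
  [:: 2; 5; 6; 7]; [:: 4; 5; 6; 7]], Sat [:: 2; 3; 6; 7], [:: (22, [:: 0; 1;
  2; 4; 3; 5; 6; 7]); (3, [:: 1; 3; 0; 2; 5; 4; 6; 7]); (3, [:: 0; 2; 1; 3; 4;
  5; 7; 6])]);
  (8, [:: [:: 0; 2; 3; 4]; [:: 2; 3; 5; 6]; [:: 2; 4; 5; 7]; [:: 3; 4; 6; 7];
  [:: 1; 5; 6; 7]], Sat [:: 0; 2; 6; 7], [:: (18, [:: 1; 5; 0; 3; 6; 2; 4;
  7]); (21, [:: 1; 0; 8; 5; 6; 7; 2; 3; 4]); (23, [:: 0; 1; 2; 7; 4; 5; 3;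
  6]); (23, [:: 0; 1; 2; 6; 3; 5; 4; 7])]);
  (7, [:: [:: 0; 1; 4; 5]; [:: 2; 3; 4; 5]; [:: 0; 2; 4; 6]; [:: 1; 3; 4; 6];
  [:: 1; 2; 5; 6]; [:: 0; 3; 5; 6]], Sat [:: 0; 1; 2; 3], [::]);
  (7, [:: [:: 1; 2; 4; 5]; [:: 0; 1; 4; 6]; [:: 2; 3; 4; 6]; [:: 0; 2; 5; 6];
  [:: 1; 3; 5; 6]; [:: 3; 4; 5; 6]], Sat [:: 0; 3; 4; 5], [::]);
  (7, [:: [:: 2; 3; 4; 5]; [:: 0; 2; 3; 6]; [:: 1; 2; 4; 6]; [:: 1; 3; 5; 6];
  [:: 0; 4; 5; 6]], Sat [:: 0; 1; 2; 5], [:: (25, [:: 0; 1; 3; 4; 2; 5; 6]);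
  (26, [:: 1; 2; 5; 0; 4; 3; 6]); (26, [:: 0; 2; 5; 1; 3; 4; 6]); (4, [:: 1;
  0; 5; 3; 4; 2; 6]); (4, [:: 0; 1; 2; 3; 4; 5; 6])]);
  (7, [:: [:: 1; 2; 4; 5]; [:: 1; 3; 4; 6]; [:: 2; 3; 5; 6]; [:: 0; 4; 5; 6]],
  Sat [:: 1; 4; 5; 6], [:: (5, [:: 0; 2; 3; 1; 5; 6; 4]); (18, [:: 7; 0; 1; 3;
  2; 4; 6; 5]); (18, [:: 7; 0; 1; 2; 3; 4; 5; 6]); (24, [:: 0; 7; 4; 5; 6; 1;
  2; 3]); (27, [:: 0; 1; 2; 3; 5; 6; 4])]);
  (6, [:: [:: 0; 1; 2; 3]; [:: 0; 1; 4; 5]; [:: 0; 2; 4; 5]; [:: 1; 3; 4; 5];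
  [:: 2; 3; 4; 5]], Sat [:: 0; 3; 4; 5], [:: (28, [:: 6; 0; 3; 5; 1; 2; 4]);
  (28, [:: 6; 0; 3; 4; 1; 2; 5])]);
  (6, [:: [:: 0; 1; 2; 3]; [:: 0; 2; 4; 5]; [:: 1; 3; 4; 5]; [:: 2; 3; 4; 5]],
  Sat [:: 0; 1; 4; 5], [:: (29, [:: 0; 1; 2; 3; 4; 5]); (5, [:: 6; 0; 1; 5; 2;
  3; 4]); (5, [:: 6; 0; 1; 4; 2; 3; 5])]);
  (6, [:: [:: 0; 1; 2; 3]; [:: 0; 1; 4; 5]; [:: 2; 3; 4; 5]], Sep 0 1, [::
  (28, [:: 6; 1; 3; 5; 0; 2; 4]); (28, [:: 6; 1; 3; 4; 0; 2; 5]); (28, [:: 6;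
  1; 2; 5; 0; 3; 4]); (28, [:: 6; 1; 2; 4; 0; 3; 5]); (28, [:: 6; 0; 3; 5; 1;
  2; 4]); (28, [:: 6; 0; 3; 4; 1; 2; 5]); (28, [:: 6; 0; 2; 5; 1; 3; 4]); (28,
  [:: 6; 0; 2; 4; 1; 3; 5]); (30, [:: 1; 5; 0; 4; 2; 3]); (30, [:: 1; 4; 0; 5;
  2; 3]); (30, [:: 1; 3; 0; 2; 4; 5]); (30, [:: 1; 2; 0; 3; 4; 5]); (30, [::
  0; 5; 1; 4; 2; 3]); (30, [:: 0; 4; 1; 5; 2; 3]); (30, [:: 0; 3; 1; 2; 4;
  5]); (30, [:: 0; 2; 1; 3; 4; 5])]);
  (8, [:: [:: 0; 2; 4; 5]; [:: 3; 4; 5; 6]; [:: 3; 4; 5; 7]; [:: 1; 3; 6; 7];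
  [:: 2; 4; 6; 7]; [:: 2; 5; 6; 7]; [:: 4; 5; 6; 7]], Sat [:: 2; 3; 4; 6],
  [::]);
  (7, [:: [:: 2; 3; 4; 5]; [:: 2; 3; 4; 6]; [:: 0; 2; 5; 6]; [:: 1; 3; 5; 6];
  [:: 1; 4; 5; 6]; [:: 3; 4; 5; 6]], Sat [:: 2; 3; 5; 6], [:: (32, [:: 0; 7;
  2; 1; 5; 6; 3; 4])]);
  (7, [:: [:: 0; 1; 4; 6]; [:: 2; 3; 4; 6]; [:: 0; 2; 5; 6]; [:: 1; 3; 5; 6];
  [:: 2; 4; 5; 6]; [:: 3; 4; 5; 6]], Sat [:: 0; 3; 5; 6], [::]);
  (7, [:: [:: 1; 3; 4; 6]; [:: 0; 1; 5; 6]; [:: 2; 3; 5; 6]; [:: 2; 4; 5; 6];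
  [:: 3; 4; 5; 6]], Sat [:: 1; 3; 4; 5], [:: (33, [:: 0; 2; 1; 3; 4; 5; 6]);
  (34, [:: 0; 1; 2; 4; 5; 3; 6]); (34, [:: 0; 1; 2; 3; 5; 4; 6])]);
  (7, [:: [:: 0; 1; 5; 6]; [:: 2; 3; 5; 6]; [:: 2; 4; 5; 6]; [:: 3; 4; 5; 6]],
  Sep 5 6, [:: (35, [:: 1; 0; 4; 2; 3; 6; 5]); (35, [:: 1; 0; 4; 2; 3; 5; 6]);
  (35, [:: 1; 0; 3; 2; 4; 6; 5]); (35, [:: 1; 0; 3; 2; 4; 5; 6]); (35, [:: 1;
  0; 2; 3; 4; 6; 5]); (35, [:: 1; 0; 2; 3; 4; 5; 6]); (35, [:: 0; 1; 4; 2; 3;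
  6; 5]); (35, [:: 0; 1; 4; 2; 3; 5; 6]); (35, [:: 0; 1; 3; 2; 4; 6; 5]); (35,
  [:: 0; 1; 3; 2; 4; 5; 6]); (35, [:: 0; 1; 2; 3; 4; 6; 5]); (35, [:: 0; 1; 2;
  3; 4; 5; 6])]);
  (8, [:: [:: 2; 4; 5; 7]; [:: 3; 4; 6; 7]; [:: 0; 5; 6; 7]; [:: 1; 5; 6; 7];
  [:: 2; 5; 6; 7]; [:: 3; 5; 6; 7]; [:: 4; 5; 6; 7]], Sat [:: 2; 4; 5; 6], [::
  (35, [:: 8; 3; 2; 4; 6; 5; 7])]);
  (8, [:: [:: 0; 4; 5; 7]; [:: 3; 4; 6; 7]; [:: 1; 5; 6; 7]; [:: 2; 5; 6; 7];
  [:: 3; 5; 6; 7]; [:: 4; 5; 6; 7]], Sat [:: 0; 5; 6; 7], [:: (37, [:: 1; 2;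
  0; 3; 4; 5; 6; 7])]);
  (8, [:: [:: 1; 3; 4; 7]; [:: 2; 4; 5; 7]; [:: 2; 3; 6; 7]; [:: 0; 4; 6; 7];
  [:: 1; 5; 6; 7]; [:: 3; 5; 6; 7]; [:: 4; 5; 6; 7]], Sat [:: 2; 4; 6; 7],
  [::]);
  (8, [:: [:: 2; 3; 4; 7]; [:: 0; 4; 5; 7]; [:: 1; 4; 6; 7]; [:: 2; 5; 6; 7];
  [:: 3; 5; 6; 7]; [:: 4; 5; 6; 7]], Sat [:: 0; 4; 6; 7], [:: (35, [:: 3; 2;
  0; 5; 6; 4; 7]); (39, [:: 0; 3; 1; 2; 4; 6; 5; 7]); (39, [:: 0; 2; 1; 3; 4;
  6; 5; 7])]);
  (8, [:: [:: 0; 4; 5; 7]; [:: 1; 4; 6; 7]; [:: 2; 5; 6; 7]; [:: 3; 5; 6; 7];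
  [:: 4; 5; 6; 7]], Sat [:: 0; 5; 6; 7], [:: (38, [:: 1; 2; 3; 0; 4; 6; 5;
  7]); (40, [:: 0; 1; 2; 3; 4; 5; 6; 7])]);
  (9, [:: [:: 0; 3; 4; 5]; [:: 3; 5; 6; 7]; [:: 4; 5; 6; 8]; [:: 4; 5; 7; 8];
  [:: 1; 6; 7; 8]; [:: 2; 6; 7; 8]], Sat [:: 4; 5; 6; 7], [:: (35, [:: 0; 3;
  8; 6; 7; 4; 5])]);
  (9, [:: [:: 0; 3; 4; 5]; [:: 3; 5; 6; 8]; [:: 4; 5; 7; 8]; [:: 1; 6; 7; 8];
  [:: 2; 6; 7; 8]], Sat [:: 3; 5; 6; 7], [:: (42, [:: 0; 1; 2; 4; 3; 5; 7; 8;
  6]); (13, [:: 1; 2; 0; 3; 7; 4; 5; 6; 8])]);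
  (8, [:: [:: 0; 1; 5; 6]; [:: 2; 3; 4; 7]; [:: 0; 3; 6; 7]; [:: 1; 4; 6; 7];
  [:: 2; 5; 6; 7]; [:: 3; 5; 6; 7]; [:: 4; 5; 6; 7]], Sat [:: 0; 4; 6; 7],
  [::]);
  (8, [:: [:: 0; 1; 5; 6]; [:: 2; 3; 4; 7]; [:: 1; 4; 6; 7]; [:: 2; 5; 6; 7];
  [:: 3; 5; 6; 7]; [:: 4; 5; 6; 7]], Sat [:: 1; 4; 5; 7], [:: (35, [:: 3; 2;
  1; 5; 6; 4; 7]); (44, [:: 0; 1; 3; 2; 4; 5; 6; 7]); (44, [:: 0; 1; 2; 3; 4;
  5; 6; 7])]);
  (8, [:: [:: 1; 3; 4; 6]; [:: 0; 1; 5; 6]; [:: 2; 3; 4; 7]; [:: 0; 2; 5; 7];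
  [:: 3; 5; 6; 7]; [:: 4; 5; 6; 7]], Sat [:: 0; 3; 4; 5], [:: (17, [:: 2; 1;
  0; 7; 3; 4; 6; 5])]);
  (8, [:: [:: 0; 1; 5; 6]; [:: 2; 3; 4; 7]; [:: 1; 2; 6; 7]; [:: 3; 5; 6; 7];
  [:: 4; 5; 6; 7]], Sat [:: 2; 5; 6; 7], [:: (45, [:: 0; 1; 3; 4; 2; 5; 6;
  7]); (46, [:: 1; 0; 2; 3; 4; 6; 5; 7]); (17, [:: 0; 2; 1; 5; 3; 4; 7; 6])]);
  (8, [:: [:: 0; 4; 5; 7]; [:: 1; 4; 6; 7]; [:: 2; 5; 6; 7]; [:: 3; 5; 6; 7]],
  Sat [:: 4; 5; 6; 7], [:: (41, [:: 0; 1; 2; 3; 4; 5; 6; 7]); (43, [:: 8; 2;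
  3; 0; 1; 4; 5; 6; 7]); (47, [:: 1; 4; 0; 2; 3; 6; 7; 5]); (47, [:: 0; 4; 1;
  2; 3; 5; 7; 6])]);
  (7, [:: [:: 2; 3; 4; 5]; [:: 2; 3; 4; 6]; [:: 2; 3; 5; 6]; [:: 0; 4; 5; 6];
  [:: 1; 4; 5; 6]; [:: 3; 4; 5; 6]], Sat [:: 2; 4; 5; 6], [::]);
  (7, [:: [:: 2; 3; 4; 5]; [:: 2; 3; 4; 6]; [:: 2; 3; 5; 6]; [:: 0; 4; 5; 6];
  [:: 1; 4; 5; 6]], Sat [:: 2; 4; 5; 6], [:: (49, [:: 0; 1; 3; 2; 4; 5; 6]);
  (36, [:: 7; 8; 4; 5; 6; 2; 3])]);
  (7, [:: [:: 0; 1; 2; 6]; [:: 0; 1; 3; 6]; [:: 2; 3; 4; 6]; [:: 2; 3; 5; 6];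
  [:: 0; 4; 5; 6]; [:: 1; 4; 5; 6]], Sat [:: 0; 2; 4; 6], [::]);
  (7, [:: [:: 0; 1; 3; 6]; [:: 2; 3; 4; 6]; [:: 2; 3; 5; 6]; [:: 0; 4; 5; 6];
  [:: 1; 4; 5; 6]], Sat [:: 3; 4; 5; 6], [:: (35, [:: 1; 0; 2; 4; 5; 3; 6]);
  (51, [:: 0; 1; 2; 3; 4; 5; 6])]);
  (7, [:: [:: 2; 3; 4; 6]; [:: 2; 3; 5; 6]; [:: 0; 4; 5; 6]; [:: 1; 4; 5; 6]],
  Sat [:: 2; 3; 4; 5], [:: (50, [:: 0; 1; 2; 3; 4; 5; 6]); (52, [:: 0; 1; 3;
  2; 4; 5; 6]); (52, [:: 0; 1; 2; 3; 4; 5; 6])]);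
  (7, [:: [:: 0; 1; 5; 6]; [:: 2; 4; 5; 6]; [:: 3; 4; 5; 6]], Sat [:: 2; 3; 5;
  6], [:: (36, [:: 0; 1; 2; 3; 4; 5; 6]); (48, [:: 1; 7; 2; 3; 0; 6; 4; 5]);
  (48, [:: 1; 7; 2; 3; 0; 5; 4; 6]); (48, [:: 0; 7; 2; 3; 1; 6; 4; 5]); (48,
  [:: 0; 7; 2; 3; 1; 5; 4; 6]); (53, [:: 2; 3; 0; 1; 4; 6; 5]); (53, [:: 2; 3;
  0; 1; 4; 5; 6])]);
  (6, [:: [:: 0; 1; 4; 5]; [:: 2; 3; 4; 5]], Sat [:: 0; 1; 2; 3], [:: (31, [::
  0; 1; 2; 3; 4; 5]); (54, [:: 2; 3; 1; 6; 0; 4; 5]); (54, [:: 2; 3; 0; 6; 1;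
  4; 5]); (54, [:: 0; 1; 3; 6; 2; 4; 5]); (54, [:: 0; 1; 2; 6; 3; 4; 5])]);
  (5, [:: [:: 0; 1; 2; 4]; [:: 0; 1; 3; 4]; [:: 0; 2; 3; 4]; [:: 1; 2; 3; 4]],
  Sat [:: 0; 1; 2; 3], [::]);
  (5, [:: [:: 0; 1; 3; 4]; [:: 0; 2; 3; 4]; [:: 1; 2; 3; 4]], Sat [:: 0; 1; 2;
  3], [:: (56, [:: 0; 1; 2; 4; 3]); (36, [:: 5; 6; 0; 1; 2; 3; 4])]);
  (5, [:: [:: 0; 2; 3; 4]; [:: 1; 2; 3; 4]], Sat [:: 0; 1; 2; 3], [:: (57, [::
  0; 1; 4; 2; 3]); (54, [:: 5; 6; 0; 1; 3; 2; 4]); (54, [:: 5; 6; 0; 1; 2; 3;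
  4])]);
  (4, [:: [:: 0; 1; 2; 3]], Sep 0 1, [:: (55, [:: 1; 3; 4; 5; 0; 2]); (55, [::
  1; 2; 4; 5; 0; 3]); (55, [:: 0; 3; 4; 5; 1; 2]); (55, [:: 0; 2; 4; 5; 1;
  3]); (58, [:: 1; 4; 0; 2; 3]); (58, [:: 0; 4; 1; 2; 3])])].

Lemma twin_free_cert_ok : cert_ok predT true id [::] twin_free_cert.
Proof. by vm_compute. Qed.

Lemma twin_free_cert_root :
  (4, [:: [:: 0; 1; 2; 3]]) \in [seq nd.1.1 | nd <- twin_free_cert].
Proof. by vm_compute. Qed.

(** The search starts from an arbitrary edge with vertices 0 to 3. A closed branch lists at least as
    many distinct edges as vertices, and these edges form [J]. Saturation and separation are assumed
    only inside [cover E], because the lemma is applied to the outer edges alone. *)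
Lemma twin_free_dense (T : finType) (E : {set {set T}}) :
  {in E, forall f : {set T}, #|f| = 4} ->
  {in E &, forall f g : {set T}, #|f :&: g| != 1} ->
  (forall g : {set T}, g \subset cover E -> #|g| = 4 -> g \notin E ->
     exists2 f, f \in E & #|g :&: f| = 1) ->
  {in cover E &, forall u v, u != v ->
     exists2 f : {set T}, f \in E & (u \in f) != (v \in f)} ->
  E != set0 ->
  exists J : {set {set T}}, [/\ J \subset E, J != set0 & #|cover J| <= #|J|].
Proof.
move=> Ecard Efree Esat Esep /set0Pn[e eE].
have Esub : {in E, forall f : {set T}, f \subset cover E} by move=> f; apply: bigcup_sup.
have [x0 _] : exists x0, x0 \in e by apply/set0Pn; rewrite -card_gt0 Ecard.
have sub : {subset enum e <= cover E}.
  by move=> x; rewrite mem_enum; apply/subsetP/Esub.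
have real : realized x0 E (cover E) (enum e) [:: [:: 0; 1; 2; 3]].
  have sz : size (enum e) = 4 by rewrite -cardE Ecard.
  split; rewrite ?enum_uniq ?sz // => f; rewrite inE => /eqP->.
  suff -> : decode x0 (enum e) [:: 0; 1; 2; 3] = e by [].
  have eq_s : [seq nth x0 (enum e) i | i <- [:: 0; 1; 2; 3]] = enum e.
    by rewrite -[RHS](mkseq_nth x0) sz.
  by apply/setP => x; rewrite inE eq_s mem_enum.
apply: (cert_ok_refuted _ _ _ _ _ _ _ _ twin_free_cert_ok twin_free_cert_root _ real) => //.
- move=> s F [us _ codeF sE] /and3P[/= F0 lek uF].
  have cJ := card_decode_family x0 us codeF uF.
  exists [set:: [seq decode x0 s f | f <- F]]; split.
  + by apply/subsetP => f; rewrite inE => /mapP[c cF ->]; apply: sE.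
  + by rewrite -card_gt0 cJ.
  rewrite cJ (leq_trans _ lek) // -(card_sets_uniq us) subset_leq_card //.
  apply/subsetP => x /bigcupP[f]; rewrite !inE => /mapP[c cF ->].
  rewrite inE => /mapP[i ic ->]; apply: mem_nth.
  by case/and3P: (allP codeF _ cF) => _ _ /allP /(_ _ ic).
by rewrite -cardE Ecard.
Qed.

(** * Completing a partial list of the vertices of an edge *)

Lemma complete_seq (T : finType) (f : {set T}) (l : seq T) :
  uniq l -> {subset l <= f} -> exists r,
  [/\ f = [set:: l ++ r], uniq (l ++ r) & size l + size r = #|f|].
Proof.
move=> ul lf; exists (enum (f :\: [set:: l])); split.
- apply/setP => x; rewrite inE mem_cat mem_enum !inE.
  by have := lf x; case: (x \in l) => // ->.
- rewrite cat_uniq ul enum_uniq andbT /=; apply/hasPn => x.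
  by rewrite mem_enum !inE => /andP[].
rewrite -(cardsID [set:: l] f) -cardE -(card_sets_uniq ul); congr (_ + _).
by apply: eq_card => x; rewrite !inE; have := lf x; case: (x \in l) => [->//|]; rewrite andbF.
Qed.

Lemma complete1 (T : finType) (f : {set T}) a b c :
  #|f| = 4 -> uniq [:: a; b; c] -> a \in f -> b \in f -> c \in f ->
  exists d, f = quad a b c d /\ uniq [:: a; b; c; d].
Proof.
move=> cf ul af bf cf'.
have [|[|d [|? ?]] [eq_f ur]] := @complete_seq _ f _ ul; rewrite ?cf //; last by exists d.
by move=> t; rewrite !inE => /or3P[] /eqP->.
Qed.

Lemma complete2 (T : finType) (f : {set T}) a b :
  #|f| = 4 -> a != b -> a \in f -> b \in f ->
  exists c d, f = quad a b c d /\ uniq [:: a; b; c; d].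
Proof.
move=> cf ab af bf.
have ul : uniq [:: a; b] by rewrite /= inE ab.
have [|[|c [|d [|? ?]]] [eq_f ur]] := @complete_seq _ f _ ul; rewrite ?cf //; last by exists c, d.
by move=> t; rewrite !inE => /orP[] /eqP->.
Qed.

Lemma complete0 (T : finType) (f : {set T}) a b c d :
  #|f| = 4 -> uniq [:: a; b; c; d] -> a \in f -> b \in f -> c \in f -> d \in f ->
  f = quad a b c d.
Proof.
move=> cf ul af bf cf' df; apply/esym/eqP; rewrite eqEcard cf (card_sets_uniq ul) andbT.
by apply/subsetP => t; rewrite !inE => /or4P[] /eqP->.
Qed.

Lemma quad_swap (T : finType) (a b c d : T) : quad a b c d = quad a b d c.
Proof. by apply/setP => t; rewrite !inE; do ![case: eqP => //]. Qed.

(** * Twins and the lower bound n - 3 *)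

Section Saturated.
Variables (T : finType) (H : {set {set T}}).
Hypothesis H_card : {in H, forall f : {set T}, #|f| = 4}.
Hypothesis H_free : {in H &, forall f g : {set T}, #|f :&: g| != 1}.
Hypothesis H_sat : forall g : {set T}, #|g| = 4 -> g \notin H ->
  exists2 f, f \in H & #|g :&: f| = 1.

Definition twin (u v : T) := (u != v) && [forall f in H, (u \in f) == (v \in f)].

Lemma twin_mem u v f : twin u v -> f \in H -> (u \in f) = (v \in f).
Proof. by case/andP=> _ /forall_inP tw /tw /eqP. Qed.

Lemma twin_sym u v : twin u v = twin v u.
Proof. by rewrite /twin eq_sym; congr andb; apply: eq_forallb_in => f _; apply: eq_sym. Qed.

Lemma not_twin u v : u != v -> ~~ twin u v ->
  exists2 f, f \in H & (u \in f) != (v \in f).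
Proof.
rewrite /twin => -> /= /forall_inPn[f fH sepf].
by exists f.
Qed.

(** Intersection sizes become sums of four booleans, so that arguments from freeness reduce to case
    analysis on memberships. *)
Lemma quad_meet a b c d f : uniq [:: a; b; c; d] -> quad a b c d \in H -> f \in H ->
  (a \in f) + (b \in f) + (c \in f) + (d \in f) != 1.
Proof.
by move=> ul qH fH; have := H_free qH fH; rewrite card_setsI_count //= addn0 !addnA.
Qed.

Lemma quad_blocked a b c d : uniq [:: a; b; c; d] -> quad a b c d \notin H ->
  exists2 f, f \in H & (a \in f) + (b \in f) + (c \in f) + (d \in f) = 1.
Proof.
move=> ul qH; have [|f fH] := H_sat _ qH; first exact: card_sets_uniq ul.
by rewrite card_setsI_count //= addn0 !addnA; exists f.
Qed.

Lemma quad_in (a b c d : T) : uniq [:: a; b; c; d] ->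
  {in H, forall f : {set T}, (a \in f) + (b \in f) + (c \in f) + (d \in f) != 1} ->
  quad a b c d \in H.
Proof.
move=> ul free; apply: contraT => /(quad_blocked ul)[f /free /eqP].
by [].
Qed.

(* For a pair of twins the remaining pairs completing it to an edge form a
   disjoint union of cliques. *)
Lemma link_trans a b x y z : twin a b -> uniq [:: a; b; x; y; z] ->
  quad a b x y \in H -> quad a b y z \in H -> quad a b x z \in H.
Proof.
move=> tw ul xyH yzH; have ux : uniq [:: a; b; x; y] /\ uniq [:: a; b; y; z] /\
    uniq [:: a; b; x; z].
  by move: ul; rewrite /= !inE !negb_or; do ![case: (_ == _) => //].
have [u1 [u2 u3]] := ux; apply: quad_in => // f fH.
have := quad_meet u1 xyH fH; have := quad_meet u2 yzH fH.
rewrite (twin_mem tw fH); bool_cases f.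
Qed.

(** * A largest minimiser contains every edge *)

Section Minimizer.
Variables (Z X : {set T}) (F : {set {set T}}).
Hypothesis FH : F \subset H.
Hypothesis XE : X = Z :|: cover F.
(** [dense] and [shared] are what remains of the choice of [F]. If [dense] failed for [J], adding
    [J] would not increase the minimised quantity and would enlarge [F]. If [shared] failed for [h],
    deleting [h] would remove at least two vertices from [X] at the cost of one edge. *)
Hypothesis dense : forall J : {set {set T}}, J \subset H :\: F -> J != set0 ->
  #|J| < #|cover J :\: X|.
Hypothesis shared : forall h u v, h \in F -> u != v -> u \in h -> v \in h ->
  u \notin Z -> v \notin Z ->
  exists2 h', h' \in F & (h' != h) && ((u \in h') || (v \in h')).
Hypothesis Z_twin : forall p, p \in Z -> p \in cover H -> exists2 q, q \in Z & twin p q.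
Hypothesis Z_closed : forall p q, p \in Z -> twin p q -> q \in Z.
Hypothesis Z_pairs : (forall p q, twin p q -> p \in Z) \/
  exists a b c d, [/\ uniq [:: a; b; c; d], {subset [:: a; b; c; d] <= Z},
                      twin a b & twin c d].

Lemma Z_sub_X t : t \in Z -> t \in X.
Proof. by rewrite XE inE => ->. Qed.

Lemma F_sub_X f t : f \in F -> t \in f -> t \in X.
Proof. by move=> fF tf; rewrite XE inE; apply/orP; right; apply/bigcupP; exists f. Qed.

Lemma X_F t : t \in X -> t \notin Z -> exists2 f, f \in F & t \in f.
Proof. by rewrite XE in_setU => /orP[->//|/bigcupP[f fF tf] _]; exists f. Qed.

(** The computational form of [dense]: it is contradicted by listing as many distinct outer edges on
    [s] as [s] has vertices outside [X]. *)
Lemma dense_codes x0 s (L : seq (seq nat)) : uniq s ->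
  all (edge_code (size s)) L -> uniq [seq sort leq e | e <- L] ->
  all (fun e => decode x0 s e \in H :\: F) L -> 0 < size L ->
  size L < count (fun x => x \notin X) s.
Proof.
move=> us codeL uL /allP LH L0; have cJ := card_decode_family x0 us codeL uL.
rewrite -cJ; apply: leq_trans (dense _ _) _.
- by apply/subsetP => f; rewrite inE => /mapP[e eL ->]; apply: LH.
- by rewrite -card_gt0 cJ.
rewrite -size_filter -(card_sets_uniq (filter_uniq _ us)) subset_leq_card //.
apply/subsetP => x /setDP[/bigcupP[f]]; rewrite !inE => /mapP[c cL ->].
rewrite inE => /mapP[i ic ->] xX; rewrite mem_filter /= xX; apply: mem_nth.
by case/and3P: (allP codeL _ cL) => _ _ /allP /(_ _ ic).
Qed.

(** A second vertex in [X] comes from a twin when [p] lies in [Z], and otherwise from an edge of [F]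
    through [p], which cannot meet [g] in [p] alone. A third is impossible, since [dense] for the
    single edge [g] demands two new vertices. *)
Lemma outer_edge g p : g \in H :\: F -> p \in g -> p \in X ->
  exists q x y, [/\ g = quad p q x y, uniq [:: p; q; x; y], q \in X, x \notin X & y \notin X].
Proof.
move=> gHF pg pX; have [gH gF] := setDP gHF.
have [q [pq qg qX]] : exists q, [/\ p != q, q \in g & q \in X].
  have [pZ|/(X_F pX)[h hF ph]] := boolP (p \in Z); last first.
    have /set0Pn[q]: (g :&: h) :\ p != set0.
      rewrite -card_gt0; have := cardsD1 p (g :&: h).
      have := H_free gH (subsetP FH _ hF); rewrite inE pg ph /=.
      by case: #|_ :\ p| => [|?] // + eq1; rewrite eq1.
    rewrite !inE => /and3P[qp qg qh]; exists q; rewrite eq_sym qp qg; split => //.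
    exact: F_sub_X hF qh.
  have [|q qZ tw] := Z_twin pZ; first by apply/bigcupP; exists g.
  by exists q; case/andP: (tw) => -> _; rewrite -(twin_mem tw gH) pg Z_sub_X.
have [x [y [eq_g ug]]] := complete2 (H_card gH) pq pg qg.
have xyX : (x \notin X) && (y \notin X).
  have := @dense_codes p _ [:: [:: 0; 1; 2; 3]] ug isT isT.
  rewrite /= /decode /= -eq_g gHF pX qX /= addn0 => /(_ isT isT).
  by case: (x \in X); case: (y \in X).
by case/andP: xyX => xX yX; exists q, x, y.
Qed.

(** Suppose [Z] holds two twin pairs and a further pair [p], [q] lies outside [X]. Then each of the
    two pairs forms an edge with [p], [q], which makes two outer edges on two new vertices. *)
Lemma twin_in_X p q : twin p q -> p \in X.
Proof.
move=> tw; case: Z_pairs => [/(_ _ _ tw)/Z_sub_X //|[a [b [c [d [uabcd abcdZ twab twcd]]]]]].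
apply: contraT => pX.
have qX : q \notin X.
  apply: contra pX => qX; have [qZ|/(X_F qX)[h hF qh]] := boolP (q \in Z).
    by apply/Z_sub_X/(Z_closed qZ); rewrite twin_sym.
  by apply: (F_sub_X hF); rewrite (twin_mem tw (subsetP FH _ hF)).
have abcdX t : t \in [:: a; b; c; d] -> t \in X by move=> /abcdZ/Z_sub_X.
have catX l : uniq l -> {subset l <= [:: a; b; c; d]} -> uniq (l ++ [:: p; q]).
  have [pq _] := andP tw; move=> ul sub; rewrite cat_uniq ul /= inE pq !andbT orbF.
  have out z : z \notin X -> z \notin l by apply: contra => /sub/abcdX.
  by rewrite negb_or !out.
have ul : uniq [:: a; b; c; d; p; q] by apply: (catX [:: a; b; c; d]).
have link t v : twin t v -> t \in [:: a; b; c; d] -> v \in [:: a; b; c; d] ->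
    quad t v p q \in H :\: F.
  move=> twt tl vl; apply/setDP; split.
    apply: quad_in => [|f fH].
      have [tv _] := andP twt; apply: (catX [:: t; v]); first by rewrite /= inE tv.
      by move=> z; rewrite mem_seq2 => /orP[] /eqP->.
    by rewrite (twin_mem twt fH) (twin_mem tw fH); bool_cases f.
  apply: contra pX => quadF; apply: (F_sub_X quadF).
  by rewrite !inE eqxx ?orbT.
have := @dense_codes p _ [:: [:: 0; 1; 4; 5]; [:: 2; 3; 4; 5]] ul isT isT.
rewrite /= /decode /= !link ?in_cons ?eqxx ?orbT // => /(_ isT isT).
have abcd0 t : t \in [:: a; b; c; d] -> (t \notin X) = false.
  by move=> /abcdX ->.
by rewrite pX qX (abcd0 a) 1?(abcd0 b) 1?(abcd0 c) 1?(abcd0 d) // !in_cons eqxx ?orbT.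
Qed.

(** [f] must contain both twins, so it has the form [quad p q x z] with [z] new, and [link_trans]
    adds [quad p q y z]: three outer edges on the three new vertices [x], [y], [z]. *)
Lemma no_twin_half g f p q x y : g \in H :\: F -> g = quad p q x y ->
  uniq [:: p; q; x; y] -> twin p q -> p \in X -> q \in X -> x \notin X -> y \notin X ->
  f \in H -> x \in f -> y \notin f -> False.
Proof.
move=> gHF eq_g ug tw pX qX xX yX fH xf yf; have [gH _] := setDP gHF.
have pf : p \in f.
  have := quad_meet ug _ fH; rewrite -eq_g => /(_ gH).
  by rewrite -(twin_mem tw fH) xf (negbTE yf); case: (p \in f).
have qf : q \in f by rewrite -(twin_mem tw fH).
have fF : f \notin F.
  by apply: contra xX => fF; apply: F_sub_X fF xf.
have [|z [eq_f uf]] := @complete1 _ f p q x (H_card fH) _ pf qf xf.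
  by move: ug; rewrite /= !inE !negb_or; do ![case: (_ == _) => //].
have zX : z \notin X.
  have := @dense_codes p _ [:: [:: 0; 1; 2; 3]] uf isT isT.
  rewrite /= /decode /= -eq_f in_setD fF fH pX qX /= xX addn0 => /(_ isT isT).
  by case: (z \in X).
have yz : y != z by apply: contraNneq yf => ->; rewrite eq_f !inE eqxx !orbT.
have ul : uniq [:: p; q; y; x; z].
  move: ug uf yz; rewrite /= !inE !negb_or (eq_sym y x).
  by do ![case: (_ == _) => //].
have yzH : quad p q y z \in H.
  by apply: (link_trans tw ul); rewrite -?eq_f // -quad_swap -eq_g.
have yzF : quad p q y z \notin F.
  apply: contra yX => quadF; apply: (F_sub_X quadF).
  by rewrite !inE eqxx ?orbT.
have := @dense_codes p _ [:: [:: 0; 1; 2; 3]; [:: 0; 1; 3; 4]; [:: 0; 1; 2; 4]] ul isT isT.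
rewrite /= /decode /= -(quad_swap p q x y) -eq_g -eq_f !in_setD gH fH fF yzH yzF /=.
by case/setDP: gHF => _ -> /(_ isT isT); rewrite pX qX xX yX zX.
Qed.

(** A twin of [p] lies in [X] and in [g], hence is [q]. The new vertices [x], [y] cannot be twins,
    as twins lie in [X], so some edge separates them. *)
Lemma outer_no_twin g p p' : g \in H :\: F -> p \in g -> p \in X -> ~~ twin p p'.
Proof.
move=> gHF pg pX; apply/negP => tw; have [gH _] := setDP gHF.
have [q [x [y [eq_g ug qX xX yX]]]] := outer_edge gHF pg pX.
have p'X : p' \in X by apply: (@twin_in_X _ p); rewrite twin_sym.
have eq_q : p' = q.
  have: p' \in g by rewrite -(twin_mem tw gH).
  rewrite eq_g !inE => /or4P[] /eqP // eq_p'.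
  - by case/andP: tw; rewrite eq_p' eqxx.
  - by rewrite eq_p' (negbTE xX) in p'X.
  - by rewrite eq_p' (negbTE yX) in p'X.
rewrite eq_q in tw.
have xy : x != y by move: ug; rewrite /= !inE !negb_or; do ![case: (_ == _) => //].
have ntw : ~~ twin x y by apply: contra xX => /twin_in_X.
have [f fH] := not_twin xy ntw.
case xf: (x \in f); case yf: (y \in f) => // _.
  by apply: (no_twin_half gHF eq_g ug tw pX qX xX yX fH xf); rewrite yf.
apply: (no_twin_half gHF (etrans eq_g (quad_swap _ _ _ _)) _ tw pX qX yX xX fH yf);
  last by rewrite xf.
by move: ug; rewrite /= !inE !negb_or (eq_sym y x); do ![case: (_ == _) => //].
Qed.

(* The crucial case: two outer edges meet [X] in two different pairs.  Put
   [R = {u, v, w}].  Every edge of [F] contains [R] or misses it, and an outer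
   edge meeting [R] does so in two vertices.  So [u v w x] is blocked by some
   [x y z q], after which [v w y z] is neither an edge nor blocked without
   violating [dense]. *)
Lemma no_split_core u v w x y z :
  quad u v x y \in H :\: F -> quad u w x z \in H :\: F ->
  uniq [:: u; v; x; y] -> uniq [:: u; w; x; z] -> v != w ->
  u \in X -> v \in X -> w \in X -> x \notin X -> y \notin X -> z \notin X -> False.
Proof.
move=> gHF g'HF ug ug' vw uX vX wX xX yX zX.
have [[gH gF] [g'H g'F]] := (setDP gHF, setDP g'HF).
have neX t t' : t \in X -> t' \notin X -> t != t'.
  by move=> tX; apply: contraNneq => <-.
(* If [y = z], two outer edges would bring only the two new vertices [x] and [y]. *)
have yz : y != z.
  apply/eqP => yz; have ul : uniq [:: u; v; w; x; y].
    move: ug ug' vw (neX w y wX yX); rewrite /= !inE !negb_or.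
    by do ![case: (_ == _) => //].
  have := @dense_codes u _ [:: [:: 0; 1; 3; 4]; [:: 0; 2; 3; 4]] ul isT isT.
  by rewrite /= /decode /= gHF yz g'HF uX vX wX xX zX => /(_ isT isT).
have ul : uniq [:: u; v; w; x; y; z].
  move: ug ug' vw yz (neX w y wX yX) (neX v z vX zX); rewrite /= !inE !negb_or.
  by do ![case: (_ == _) => //].
have TX t : t \in [:: u; v; w] -> t \in X.
  by rewrite !inE => /or3P[] /eqP->.
(* A vertex of [Z] on an outer edge has a twin, which [outer_no_twin] forbids. *)
have TZ t : t \in [:: u; v; w] -> t \notin Z.
  move=> tT; apply/negP => tZ.
  have [g2 g2HF tg2] : exists2 g2, g2 \in H :\: F & t \in g2.
    move: tT; rewrite !inE => /or3P[] /eqP->; [exists (quad u v x y)|exists (quad u v x y)|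
      exists (quad u w x z)] => //; by rewrite !inE eqxx ?orbT.
  have [|q qZ tw] := Z_twin tZ.
    by apply/bigcupP; exists g2 => //; case/setDP: g2HF.
  by have := outer_no_twin q g2HF tg2 (TX _ tT); rewrite tw.
have FX f t : f \in F -> t \notin X -> t \notin f.
  by move=> fF; apply: contra; apply: F_sub_X.
have inF f : f \in F -> ((u \in f) = (v \in f)) * ((u \in f) = (w \in f)).
  move=> fF; have fH := subsetP FH _ fF.
  have := quad_meet ug gH fH; have := quad_meet ug' g'H fH.
  rewrite (negbTE (FX f x fF xX)) (negbTE (FX f y fF yX)) (negbTE (FX f z fF zX)).
  bool_cases f.
have inT f p0 : f \in H :\: F -> p0 \in [:: u; v; w] -> p0 \in f ->
    (u \in f) + (v \in f) + (w \in f) = 2.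
  move=> fHF p0T p0f; have [fH fF] := setDP fHF.
  have [p1 [x1 [y1 [eq_f uf p1X x1X y1X]]]] := outer_edge fHF p0f (TX _ p0T).
  have [h hF uh] : exists2 h, h \in F & u \in h.
    have := TZ u; rewrite inE eqxx => /(_ isT) uZ.
    by have [h] := X_F uX uZ; exists h.
  have TF h' : h' \in F -> u \in h' -> [&& v \in h', w \in h' & p1 \in h'].
    move=> h'F uh'; have [<- <-] := inF _ h'F; rewrite uh' /=.
    have p0h' : p0 \in h'.
      by move: p0T; have [eq1 eq2] := inF _ h'F; rewrite !inE => /or3P[] /eqP->; rewrite -?eq1 -?eq2.
    have := quad_meet uf _ (subsetP FH _ h'F); rewrite -eq_f => /(_ fH).
    by rewrite p0h' (negbTE (FX _ _ h'F x1X)) (negbTE (FX _ _ h'F y1X)); case: (p1 \in h').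
  have p1T : p1 \in [:: u; v; w].
    (* Otherwise every edge of [F] through [u] equals [{u, v, w, p1}], so there is only one, while
       [shared] demands another through [u] or [v]. *)
    apply: contraT => p1T; have uv : u != v by move: ul; rewrite /= inE negb_or => /andP[/andP[]].
    have /and3P[vh wh p1h] := TF h hF uh.
    have [||h' h'F /andP[h'h]] := shared hF uv uh vh.
    - by apply: TZ; rewrite inE eqxx.
    - by apply: TZ; rewrite !inE eqxx orbT.
    have [<- _] := inF _ h'F; rewrite orbb => uh'.
    have /and3P[vh' wh' p1h'] := TF h' h'F uh'.
    have uq : uniq [:: u; v; w; p1].
      move: ul p1T; rewrite /= !inE !negb_or !(eq_sym p1).
      by do ![case: (_ == _) => //].
    move: h'h; rewrite (complete0 (H_card (subsetP FH _ hF)) uq) //.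
    by rewrite (complete0 (H_card (subsetP FH _ h'F)) uq) // eqxx.
  have fT t : t \in [:: u; v; w] -> (t \in f) = (t == p0) || (t == p1).
    move=> /TX tX; rewrite eq_f !inE (negbTE (neX _ _ tX x1X)) (negbTE (neX _ _ tX y1X)).
    by rewrite !orbF.
  rewrite !fT ?in_cons ?eqxx ?orbT //.
  have: p0 != p1 by move: uf; rewrite /= inE negb_or => /andP[/andP[]].
  have [uv uw] : (u == v) = false /\ (u == w) = false.
    by move: ul; rewrite /= !inE; do ![case: (_ == _) => //].
  move: p0T p1T; rewrite !inE => /or3P[] /eqP-> /or3P[] /eqP->; rewrite ?eqxx //;
    by rewrite ?(eq_sym v u) ?(eq_sym w u) ?(eq_sym w v) ?uv ?uw ?(negbTE vw) ?eqxx.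
have sumT f : f \in H -> f \notin F -> [\/ [/\ u \notin f, v \notin f & w \notin f],
    [/\ u \in f, v \in f & w \notin f], [/\ u \in f, v \notin f & w \in f]
    | [/\ u \notin f, v \in f & w \in f]].
  move=> fH fF; have fHF : f \in H :\: F by rewrite in_setD fH fF.
  have := (inT f u fHF, inT f v fHF, inT f w fHF).
  rewrite !in_cons !eqxx !orbT; case: (u \in f); case: (v \in f); case: (w \in f) => -[[h1 h2] h3];
    by [constructor 1 | constructor 2 | constructor 3 | constructor 4
       | have := h1 isT isT | have := h2 isT isT | have := h3 isT isT].
have notF t (q : {set T}) : t \notin X -> t \in q -> q \notin F.
  by move=> tX tq; apply: contra tX => qF; apply: F_sub_X qF tq.
have [f1 f1H [xf1 yf1 zf1]] : exists2 f1, f1 \in H & [/\ x \in f1, y \in f1 & z \in f1].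
  have uq : uniq [:: u; v; w; x] by move: ul; rewrite /= !inE !negb_or; do ![case: (_ == _) => //].
  have qH : quad u v w x \notin H.
    apply/negP => qH; have qF : quad u v w x \notin F.
      by apply: (notF x) => //; rewrite !inE eqxx !orbT.
    have := @dense_codes u _ [:: [:: 0; 1; 3; 4]; [:: 0; 2; 3; 5]; [:: 0; 1; 2; 3]] ul isT isT.
    by rewrite /= /decode /= gHF g'HF in_setD qH qF uX vX wX xX yX zX => /(_ isT isT).
  have [f fH eq1] := quad_blocked uq qH; exists f => //.
  have [fF|fF] := boolP (f \in F).
    move: eq1; have [<- <-] := inF _ fF; rewrite (negbTE (FX _ _ fF xX)).
    by case: (u \in f).
  have m1 := quad_meet ug gH fH; have m2 := quad_meet ug' g'H fH; move: eq1 m1 m2.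
  case: (sumT f fH fF) => -[uf vf wf]; rewrite ?uf ?vf ?wf ?(negbTE uf) ?(negbTE vf) ?(negbTE wf) //=.
  by case: (x \in f); case: (y \in f); case: (z \in f).
have [|q [eq_f1 uf1]] := @complete1 _ f1 x y z (H_card f1H) _ xf1 yf1 zf1.
  by move: ul; rewrite /= !inE !negb_or; do ![case: (_ == _) => //].
have f1F : f1 \notin F by apply: (notF x).
have f1HF : quad x y z q \in H :\: F by rewrite -eq_f1 in_setD f1F f1H.
have qX : q \notin X.
  apply/negP => qX; have qf1 : q \in quad x y z q by rewrite !inE eqxx !orbT.
  have [q2 [x2 [y2 [eq_f2 uf2 q2X _ _]]]] := outer_edge f1HF qf1 qX.
  have: q2 \in quad x y z q by rewrite eq_f2 !inE eqxx !orbT.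
  have: q2 != q by move: uf2; rewrite /= inE negb_or eq_sym => /andP[/andP[]].
  rewrite !inE => /negbTE-> /or4P[] // /eqP eq_q2; move: q2X; rewrite eq_q2.
  - by rewrite (negbTE xX).
  - by rewrite (negbTE yX).
  - by rewrite (negbTE zX).
have ul7 : uniq [:: u; v; w; x; y; z; q].
  move: ul uf1 (neX u q uX qX) (neX v q vX qX) (neX w q wX qX).
  by rewrite /= !inE !negb_or; do ![case: (_ == _) => //].
(* Three outer edges are known, and among these seven vertices only [x], [y], [z], [q] are new, so a
   fourth outer edge contradicts [dense]. *)
have no4 e : edge_code 7 e -> [:: 0; 1; 3; 4] != sort leq e ->
    [:: 0; 2; 3; 5] != sort leq e -> [:: 3; 4; 5; 6] != sort leq e ->
    decode u [:: u; v; w; x; y; z; q] e \in H :\: F -> False.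
  move=> code_e e1 e2 e3 eHF.
  pose L := [:: [:: 0; 1; 3; 4]; [:: 0; 2; 3; 5]; [:: 3; 4; 5; 6]; e].
  have codeL : all (edge_code 7) L by rewrite /= code_e.
  have uL : uniq [seq sort leq e | e <- L] by rewrite /= !inE !negb_or e1 e2 e3.
  have LHF : all (fun e => decode u [:: u; v; w; x; y; z; q] e \in H :\: F) L.
    by rewrite /= eHF /decode /= gHF g'HF f1HF.
  have := dense_codes ul7 codeL uL LHF isT.
  by rewrite /= uX vX wX xX yX zX qX.
have uq : uniq [:: v; w; y; z] by move: ul; rewrite /= !inE !negb_or; do ![case: (_ == _) => //].
have qH : quad v w y z \notin H.
  apply/negP => qH; apply: (@no4 [:: 1; 2; 4; 5]) => //; rewrite /decode /= in_setD qH andbT.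
  by apply: (notF y) => //; rewrite !inE eqxx !orbT.
have [f fH eq1] := quad_blocked uq qH.
have [fF|fF] := boolP (f \in F).
  move: eq1; have [<- <-] := inF _ fF; rewrite (negbTE (FX _ _ fF yX)) (negbTE (FX _ _ fF zX)).
  by case: (u \in f).
have m1 := quad_meet ug gH fH; have m2 := quad_meet ug' g'H fH.
have m3 : (x \in f) + (y \in f) + (z \in f) + (q \in f) != 1.
  by apply: quad_meet uf1 _ fH; rewrite -eq_f1.
move: eq1 m1 m2 m3.
case: (sumT f fH fF) => -[uf vf wf]; rewrite ?uf ?vf ?wf ?(negbTE uf) ?(negbTE vf) ?(negbTE wf) //=.
- by case: (x \in f); case: (y \in f); case: (z \in f).
- case yf: (y \in f); case zf: (z \in f); case xf: (x \in f); case qf: (q \in f) => // _ _ _ _.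
  have fE : f = quad u v x q.
    apply: complete0 => //; first exact: H_card.
    by move: ul7; rewrite /= !inE !negb_or; do ![case: (_ == _) => //].
  by apply: (@no4 [:: 0; 1; 3; 6]) => //; rewrite /decode /= -fE in_setD fH fF.
- case yf: (y \in f); case zf: (z \in f); case xf: (x \in f); case qf: (q \in f) => // _ _ _ _.
  have fE : f = quad u w x q.
    apply: complete0 => //; first exact: H_card.
    by move: ul7; rewrite /= !inE !negb_or; do ![case: (_ == _) => //].
  by apply: (@no4 [:: 0; 2; 3; 6]) => //; rewrite /decode /= -fE in_setD fH fF.
Qed.

(** [f] is outer, since an edge of [F] would meet [g] only in [u]. So [f] has a second vertex [w] in
    [X], different from [v], and must share with [g] one of the new vertices [x], [y]. *)
Lemma no_split_half g f u v x y : g \in H :\: F -> g = quad u v x y ->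
  uniq [:: u; v; x; y] -> u \in X -> v \in X -> x \notin X -> y \notin X ->
  f \in H -> u \in f -> v \notin f -> False.
Proof.
move=> gHF eq_g ug uX vX xX yX fH uf vf; have [gH gF] := setDP gHF.
have [g0 [ug0 ug1]] : (quad u v x y \in H) /\ uniq [:: u; v; y; x] /\ quad u v y x \in H :\: F.
  rewrite (quad_swap u v y x) -eq_g; split=> //; split=> //.
  by move: ug; rewrite /= !inE !negb_or (eq_sym y x); do ![case: (_ == _) => //].
have m := quad_meet ug g0 fH.
have fF : f \notin F.
  apply/negP => fF; move: m; rewrite uf (negbTE vf).
  rewrite (negbTE (contra (F_sub_X fF) xX)) (negbTE (contra (F_sub_X fF) yX)).
  by [].
have fHF : f \in H :\: F by rewrite in_setD fF fH.
have [w [p [q [eq_f uf' wX pX qX]]]] := outer_edge fHF uf uX.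
have vw : v != w by apply: contraNneq vf => ->; rewrite eq_f !inE eqxx orbT.
have uf2 : uniq [:: u; w; q; p].
  by move: uf'; rewrite /= !inE !negb_or (eq_sym q p); do ![case: (_ == _) => //].
have f1 : quad u w p q \in H :\: F by rewrite -eq_f.
have f2 : quad u w q p \in H :\: F by rewrite quad_swap.
have neX t t' : t \in X -> t' \notin X -> (t == t') = false.
  by move=> tX; apply: contraNF => /eqP <-.
have: (x \in f) || (y \in f).
  by move: m; rewrite uf (negbTE vf); case: (x \in f); case: (y \in f).
rewrite eq_f !inE !(eq_sym _ u) !(eq_sym _ w) !(neX u) ?(neX w) //=.
rewrite eq_g in gHF.
(* The shared new vertex is [x] or [y] in [g], and [p] or [q] in [f]; reordering puts it third in
   both edges. *)
case/orP=> /orP[] /eqP eq_xy.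
- by rewrite -eq_xy in f1 uf'; exact: (no_split_core gHF f1).
- by rewrite -eq_xy in f2 uf2; exact: (no_split_core gHF f2).
- by rewrite -eq_xy in f1 uf'; exact: (no_split_core ug1 f1).
- by rewrite -eq_xy in f2 uf2; exact: (no_split_core ug1 f2).
Qed.

Lemma outer_disjoint g p : g \in H :\: F -> p \in g -> p \notin X.
Proof.
move=> gHF pg; apply/negP => pX.
have [q [x [y [eq_g ug qX xX yX]]]] := outer_edge gHF pg pX.
have pq : p != q by move: ug; rewrite /= inE negb_or => /andP[/andP[]].
have [f fH] := not_twin pq (outer_no_twin q gHF pg pX).
case pf: (p \in f); case qf: (q \in f) => // _.
  by apply: (no_split_half gHF eq_g ug pX qX xX yX fH pf); rewrite qf.
have eq_g' : g = quad q p x y.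
  by rewrite eq_g; apply/setP => t; rewrite !inE; do ![case: eqP => //].
apply: (no_split_half gHF eq_g' _ qX pX xX yX fH qf); rewrite ?pf //.
by move: ug; rewrite /= !inE !negb_or (eq_sym q p); do ![case: (_ == _) => //].
Qed.

(** If outer edges existed, they would be disjoint from [X] and form a saturated twin-free family,
    and the dense subfamily found there would contradict [dense]. *)
Lemma minimizer_all : F = H.
Proof.
apply/eqP; rewrite eqEsubset FH -setD_eq0; apply: contraT => HF0.
have outer t : t \in cover (H :\: F) -> t \notin X.
  by case/bigcupP => g gHF; apply: outer_disjoint gHF.
(* Any edge touching an outer vertex is outer, so blocking and separating edges remain inside
   [H :\: F]. *)
have inner t f : t \in cover (H :\: F) -> f \in H -> t \in f -> f \in H :\: F.
  move=> /outer tX fH tf; rewrite in_setD fH andbT.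
  by apply: contra tX => fF; apply: F_sub_X fF tf.
have [|||||J [JHF J0 Jle]] := @twin_free_dense _ (H :\: F) => //.
- by move=> f /setDP[/H_card].
- by move=> f g /setDP[fH _] /setDP[gH _]; apply: H_free.
- move=> g gD cg gHF; have gH : g \notin H.
    apply: contra gHF => gH; have [t tg] : exists t, t \in g by apply/set0Pn; rewrite -card_gt0 cg.
    by apply: (inner t) => //; apply: (subsetP gD).
  have [f fH eq1] := H_sat cg gH; exists f => //.
  have [t] : exists t, t \in g :&: f by apply/set0Pn; rewrite -card_gt0 eq1.
  by rewrite inE => /andP[tg tf]; apply: (inner t) => //; apply: (subsetP gD).
- move=> s t sD tD st; have ntw : ~~ twin s t.
    by apply: contra (outer s sD) => /twin_in_X.
  have [f fH sepf] := not_twin st ntw; exists f => //.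
  move: sepf; case sf: (s \in f); case tf: (t \in f) => // _.
    exact: inner sD fH sf.
  exact: inner tD fH tf.
have := dense JHF J0; rewrite ltnNge (leq_trans _ Jle) // subset_leq_card //.
exact: subsetDl.
Qed.

End Minimizer.

(** * From the minimiser to the bound *)

(** Besides what [minimizer_all] asks of [Z], the isolated vertices must lie in [Z], so that [F = H]
    makes [X] the whole vertex set. *)
Definition twin_kernel (Z : {set T}) :=
  [/\ forall p, p \in Z -> p \in cover H -> exists2 q, q \in Z & twin p q,
      forall p q, p \in Z -> twin p q -> q \in Z,
      (forall p q, twin p q -> p \in Z) \/
        exists a b c d, [/\ uniq [:: a; b; c; d], {subset [:: a; b; c; d] <= Z},
                            twin a b & twin c d]
    & ~: cover H \subset Z].

(** [F0] only serves as a competitor. The minimum is attained at [H], where its value is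
    [|T| - |H|], and it is at most the value [c] allowed at [F0]. *)
Lemma twin_kernel_bound (Z : {set T}) (F0 : {set {set T}}) c : twin_kernel Z -> F0 \subset H ->
  #|Z :|: cover F0| <= #|F0| + c -> #|T| <= #|H| + c.
Proof.
move=> [Z_twin Z_closed Z_pairs isoZ] F0H le0.
(* Lexicographic: minimise [|Z ∪ V(F)| - |F|] first, then [- |F|]. *)
pose w (F : {set {set T}}) := #|H|.+1 * #|Z :|: cover F| + #|H|.+2 * (#|H| - #|F|).
case: (@arg_minnP _ F0 (fun F => F \subset H) w F0H) => F FH Fmin.
have leF (F' : {set {set T}}) : F' \subset H -> #|F'| <= #|H| by apply: subset_leq_card.
have FE : F = H.
  apply: (@minimizer_all Z (Z :|: cover F) F) => //.
  - move=> J JHF J0; have JH : J \subset H by apply: subset_trans JHF (subsetDl _ _).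
    have FJ : [disjoint F & J].
      rewrite -setI_eq0; apply/eqP/setP => f; rewrite !inE; apply/negP => /andP[fF fJ].
      by have := subsetP JHF _ fJ; rewrite inE fF.
    have FJH : F :|: J \subset H by rewrite subUset FH.
    have cFJ : #|F :|: J| = #|F| + #|J| by apply/eqP; rewrite (leq_card_setU F J).
    have cX : #|Z :|: cover (F :|: J)| <= #|Z :|: cover F| + #|cover J :\: (Z :|: cover F)|.
      apply: leq_trans (leq_card_setU _ _); apply: subset_leq_card; apply/subsetP => t.
      rewrite /cover bigcup_setU !inE -!/(cover _).
      by case: (t \in Z); case: (t \in cover F); case: (t \in cover J).
    have := Fmin _ FJH; have := leF _ FJH; rewrite /w cFJ.
    have : 0 < #|J| by rewrite card_gt0.
    move: cX; move: #|cover J :\: _| => d; move: #|Z :|: cover (F :|: J)| => x'.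
    move: #|Z :|: cover F| #|J| #|F| #|H| => x j f m.
    clear; nia.
  - move=> h u v hF uv uh vh uZ vZ.
    have [/exists_inP[h' h'F h'P]|none] := boolP [exists h' in F, (h' != h) && ((u \in h') || (v \in h'))].
      by exists h'.
    have only h' : h' \in F -> h' != h -> (u \notin h') && (v \notin h').
      move=> h'F h'h; move: none; rewrite negb_exists => /forallP/(_ h').
      by rewrite h'F h'h /= negb_or.
    have FhH : F :\ h \subset H by apply: subset_trans FH; apply: subsetDl.
    have cF : #|F| = #|F :\ h|.+1 by rewrite (cardsD1 h) hF.
    have memX t : t \in h -> t \in Z :|: cover F.
      by move=> th; rewrite inE; apply/orP; right; apply/bigcupP; exists h.
    have cX : #|Z :|: cover (F :\ h)| + 2 <= #|Z :|: cover F|.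
      rewrite -[2](_ : #|[set u; v]| = 2); last by rewrite cards2 uv.
      have <- : #|(Z :|: cover (F :\ h)) :|: [set u; v]|
          = #|Z :|: cover (F :\ h)| + #|[set u; v]|.
        apply/eqP; rewrite (leq_card_setU _ _) disjoint_sym disjoints_subset.
        apply/subsetP => t; rewrite !inE => t_uv; rewrite negb_or.
        have tZ : t \notin Z by case/orP: t_uv => /eqP->.
        rewrite tZ /=; apply/bigcupP => -[h']; rewrite !inE => /andP[h'h h'F].
        by case/andP: (only _ h'F h'h) => uh' vh'; case/orP: t_uv => /eqP->; apply/negP.
      apply: subset_leq_card; apply/subsetP => t; rewrite !inE => /orP[/orP[->//|]|].
        case/bigcupP => h'; rewrite !inE => /andP[_ h'F] th'; apply/orP; right.
        by apply/bigcupP; exists h'.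
      by case/orP=> /eqP->; have := memX _ uh; have := memX _ vh; rewrite !inE.
    have := Fmin _ FhH; have := leF _ FH; rewrite /w cF.
    move: cX; move: #|Z :|: cover (F :\ h)| => x'; move: #|Z :|: cover F| #|F :\ h| #|H| => x f m.
    clear; nia.
have XT : Z :|: cover F = setT.
  apply/setP => t; rewrite !inE FE.
  by have := subsetP isoZ t; rewrite inE; case: (t \in cover H) => [_|->]; rewrite ?orbT.
have := Fmin _ F0H; have := leF _ F0H; rewrite /w XT FE cardsT subnn muln0 addn0.
move: le0; move: #|Z :|: cover F0| => x; move: #|F0| #|H| #|T| => f m k.
clear; nia.
Qed.

(** Every edge meets a union of two disjoint twin pairs in an even number of vertices. *)
Lemma pair_quad a b c d : uniq [:: a; b; c; d] -> twin a b -> twin c d -> quad a b c d \in H.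
Proof.
move=> ul twab twcd; apply: quad_in => // f fH.
by rewrite (twin_mem twab fH) (twin_mem twcd fH); bool_cases f.
Qed.

Lemma isolated_twin i j : i \notin cover H -> j \notin cover H -> i != j -> twin i j.
Proof.
move=> iH jH ij; rewrite /twin ij; apply/forall_inP => f fH; apply/eqP.
have out k : k \notin cover H -> (k \in f) = false.
  by apply: contraNF => kf; apply/bigcupP; exists f.
by rewrite !out.
Qed.

Lemma quad_cover a b c d t : quad a b c d \in H -> t \in [:: a; b; c; d] -> t \in cover H.
Proof. by move=> qH tq; apply/bigcupP; exists (quad a b c d); rewrite // inE. Qed.

(** Here [Z] consists of the two pairs and the isolated vertices. It is closed under twins because
    [quad a b c d] is an edge and so contains every twin of its vertices. *)
Lemma pairs_bound a b c d (F0 : {set {set T}}) : uniq [:: a; b; c; d] ->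
  twin a b -> twin c d -> F0 \subset H ->
  #|quad a b c d :|: ~: cover H :|: cover F0| <= #|F0| + 3 -> #|T| <= #|H| + 3.
Proof.
move=> ul twab twcd F0H; apply: twin_kernel_bound => //.
have qH := pair_quad ul twab twcd.
split.
- move=> p; rewrite in_setU in_setC => pZ pH; move: pZ; rewrite pH orbF inE.
  have inZ t : t \in [:: a; b; c; d] -> t \in quad a b c d :|: ~: cover H.
    by move=> tl; rewrite in_setU inE tl.
  rewrite !in_cons orbF => /or4P[] /eqP ->;
    [exists b|exists a|exists d|exists c]; rewrite ?inZ ?in_cons ?eqxx ?orbT // twin_sym //.
- move=> p q; rewrite !in_setU !in_setC => /orP[pq|pH] tw.
    by rewrite -(twin_mem tw qH) pq.
  apply/orP; right; apply: contra pH => /bigcupP[f fH qf].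
  by apply/bigcupP; exists f; rewrite // (twin_mem tw fH).
- right; exists a, b, c, d; split=> // t tl; by rewrite in_setU inE tl.
exact: subsetUr.
Qed.

(** The 2 in [size L + 2] leaves room for the possible isolated vertex [t] within the final 3. *)
Lemma codes_bound x0 s (L : seq (seq nat)) t a b c d : uniq s ->
  all (edge_code (size s)) L -> uniq [seq sort leq e | e <- L] ->
  all (fun e => decode x0 s e \in H) L -> size s <= size L + 2 ->
  uniq [:: a; b; c; d] -> twin a b -> twin c d -> {subset [:: a; b; c; d] <= s} ->
  ~: cover H \subset [set t] -> #|T| <= #|H| + 3.
Proof.
move=> us codeL uL /allP LH lesL ul twab twcd subs iso.
have cJ := card_decode_family x0 us codeL uL.
apply: (pairs_bound (F0 := [set:: [seq decode x0 s e | e <- L]]) ul twab twcd).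
  by apply/subsetP => f; rewrite inE => /mapP[e eL ->]; apply: LH.
rewrite cJ; apply: (@leq_trans #|[set:: t :: s]|); last first.
  apply: leq_trans (_ : size (t :: s) <= _); last by rewrite /= addnS ltnS.
  by apply: leq_trans (card_size (t :: s)); apply: subset_leq_card; apply/subsetP => z; rewrite inE.
apply: subset_leq_card; apply/subsetP => z; rewrite !in_setU => /orP[/orP[]|].
- by rewrite !inE => zl; rewrite (subs z) ?orbT // !inE.
- by move/(subsetP iso); rewrite !inE => ->.
case/bigcupP => f; rewrite !inE => /mapP[e eL ->]; rewrite inE => /mapP[i ie ->].
rewrite mem_nth ?orbT //.
by case/and3P: (allP codeL _ eL) => _ _ /allP /(_ _ ie).
Qed.

(** The six unions of two of the four pairs are edges on eight vertices. *)
Lemma eight_bound a b c d e f g h t : uniq [:: a; b; c; d; e; f; g; h] ->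
  twin a b -> twin c d -> twin e f -> twin g h -> ~: cover H \subset [set t] ->
  #|T| <= #|H| + 3.
Proof.
move=> ul twab twcd twef twgh.
apply: (@codes_bound a _ [:: [:: 0; 1; 2; 3]; [:: 0; 1; 4; 5]; [:: 0; 1; 6; 7];
    [:: 2; 3; 4; 5]; [:: 2; 3; 6; 7]; [:: 4; 5; 6; 7]] t a b c d ul) => //.
- by rewrite /= /decode /= !pair_quad //;
    move: ul; rewrite /= !inE !negb_or; do ![case: (_ == _) => //].
- by move: ul; rewrite /= !inE !negb_or; do ![case: (_ == _) => //].
by move=> z; rewrite !inE => /or4P[] ->; rewrite ?orbT.
Qed.

Lemma twin_outside a b c d x z : twin a b -> quad c d x z \in H ->
  uniq [:: a; b; c; d; x] -> (a != z) && (b != z).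
Proof.
move=> tw qH ul; have := twin_mem tw qH; rewrite !inE.
move: ul; rewrite /= !inE !negb_or; case: (a =P z) => [<-|_]; rewrite ?eqxx ?(eq_sym b a).
all: by do ![case: (_ == _) => //].
Qed.

(** [f] has the form [quad a b x z], so [x], [y], [z] form a triangle in the link of [a], [b]. As
    [t] is isolated, the 4-set [x y z t] is blocked, by an edge [g] containing exactly one of [x],
    [y], [z]. Freeness forces [a] and [b] into [g], and its fourth vertex [w] extends the triangle
    to a 4-clique. *)
Lemma clique_half a b x y t f : twin a b -> quad a b x y \in H -> uniq [:: a; b; x; y] ->
  t \notin cover H -> f \in H -> x \in f -> y \notin f ->
  exists z w, uniq [:: a; b; x; y; z; w] /\
    [&& quad a b x z \in H, quad a b y z \in H, quad a b x w \in H, quad a b y w \in H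
      & quad a b z w \in H].
Proof.
move=> tw xyH ug tH fH xf yf.
have af : a \in f.
  have := quad_meet ug xyH fH.
  by rewrite -(twin_mem tw fH) xf (negbTE yf); case: (a \in f).
have bf : b \in f by rewrite -(twin_mem tw fH).
have [|z [eq_f uf]] := @complete1 _ f a b x (H_card fH) _ af bf xf.
  by move: ug; rewrite /= !inE !negb_or; do ![case: (_ == _) => //].
rewrite eq_f in fH.
have yz : y != z by apply: contraNneq yf => ->; rewrite eq_f !inE eqxx !orbT.
have ul : uniq [:: a; b; y; x; z].
  by move: ug uf yz; rewrite /= !inE !negb_or (eq_sym y x); do ![case: (_ == _) => //].
have yzH : quad a b y z \in H by apply: (link_trans tw ul) => //; rewrite quad_swap.
have ne_t s : s \in cover H -> s != t by apply: contraTneq => ->.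
have ut : uniq [:: x; y; z; t].
  have xt : x != t by apply/ne_t/(quad_cover xyH); rewrite !in_cons eqxx ?orbT.
  have yt : y != t by apply/ne_t/(quad_cover xyH); rewrite !in_cons eqxx ?orbT.
  have zt : z != t by apply/ne_t/(quad_cover fH); rewrite !in_cons eqxx ?orbT.
  by move: ul xt yt zt; rewrite /= !inE !negb_or (eq_sym y x); do ![case: (_ == _) => //].
have [|g gH eq1] := quad_blocked ut.
  by apply: contra tH => qH; apply: (quad_cover qH); rewrite !inE eqxx !orbT.
have tg : (t \in g) = false by apply: contraNF tH => tg; apply/bigcupP; exists g.
have m1 := quad_meet ug xyH gH; have m2 := quad_meet uf fH gH.
have ag : a \in g.
  move: eq1 m1 m2; rewrite tg -(twin_mem tw gH).
  by case: (a \in g); case: (x \in g); case: (y \in g); case: (z \in g).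
have bg : b \in g by rewrite -(twin_mem tw gH).
(* One link from [w] to the triangle suffices; [link_trans] gives the other two. *)
exists z; suff [w [uw xw]] : exists w, uniq [:: a; b; x; y; z; w] /\
    [|| quad a b x w \in H, quad a b y w \in H | quad a b z w \in H].
  exists w; split => //; rewrite fH yzH /=.
  have sym v v' : quad a b v v' \in H -> quad a b v' v \in H by rewrite quad_swap.
  have tr v v' : uniq [:: a; b; v; v'; w] -> quad a b v v' \in H -> quad a b v' w \in H ->
    quad a b v w \in H by move=> u1; apply: link_trans.
  have [u1 [u2 [u3 [u4 [u5 u6]]]]] : uniq [:: a; b; x; y; w] /\ uniq [:: a; b; y; x; w] /\
      uniq [:: a; b; x; z; w] /\ uniq [:: a; b; z; x; w] /\ uniq [:: a; b; y; z; w] /\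
      uniq [:: a; b; z; y; w].
    move: uw; rewrite /= !inE !negb_or (eq_sym y x) (eq_sym z x) (eq_sym z y).
    by do ![case: (_ == _) => //].
  case/or3P: xw => wH.
  - by rewrite wH (tr y x) ?(tr z x) // sym.
  - by rewrite wH (tr x y) ?(tr z y) // sym.
  - by rewrite wH (tr x z) ?(tr y z).
have uxyz : uniq [:: a; b; x; y; z].
  by move: ul; rewrite /= !inE !negb_or (eq_sym y x); do ![case: (_ == _) => //].
have [u1 [u2 u3]] : uniq [:: a; b; x] /\ uniq [:: a; b; y] /\ uniq [:: a; b; z].
  by move: uxyz; rewrite /= !inE !negb_or; do ![case: (_ == _) => //].
have fresh s w : uniq [:: a; b; s; w] -> g = quad a b s w ->
    {in [:: x; y; z], forall r, r != s -> r \notin g} -> s \in [:: x; y; z] ->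
    uniq [:: a; b; x; y; z; w].
  move=> us eq_g out sl.
  have xw r : r \in [:: x; y; z] -> r != w.
    move=> rl; case: (r =P s) => [->|/eqP rs].
      by move: us; rewrite /= !inE !negb_or; do ![case: (_ == _) => //].
    by apply: contraNneq (out _ rl rs) => ->; rewrite eq_g !inE eqxx !orbT.
  move: uxyz us (xw x) (xw y) (xw z); rewrite /= !inE !negb_or !eqxx !orbT.
  move=> + + /(_ isT) + /(_ isT) + /(_ isT).
  by do ![case: (_ == _) => //].
move: eq1; rewrite tg addn0.
case xg: (x \in g); case yg: (y \in g); case zg: (z \in g) => // _.
- have [w [eq_g uw]] := complete1 (H_card gH) u1 ag bg xg.
  exists w; rewrite -eq_g gH; split=> //; apply: (fresh x w uw eq_g); rewrite ?inE ?eqxx //.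
  by move=> r; rewrite !inE => /or3P[] /eqP->; rewrite ?eqxx ?yg ?zg.
- have [w [eq_g uw]] := complete1 (H_card gH) u2 ag bg yg.
  exists w; rewrite -eq_g gH orbT; split=> //; apply: (fresh y w uw eq_g); rewrite ?inE ?eqxx ?orbT //.
  by move=> r; rewrite !inE => /or3P[] /eqP->; rewrite ?eqxx ?xg ?zg.
- have [w [eq_g uw]] := complete1 (H_card gH) u3 ag bg zg.
  exists w; rewrite -eq_g gH !orbT; split=> //; apply: (fresh z w uw eq_g); rewrite ?inE ?eqxx ?orbT //.
  by move=> r; rewrite !inE => /or3P[] /eqP->; rewrite ?eqxx ?xg ?yg.
Qed.

(** The pair [c], [d] with the six pairs of the 4-clique, together with [quad a b c d], makes seven
    edges on eight vertices. *)
Lemma clique_bound_half a b c d x y t f : twin a b -> twin c d -> quad c d x y \in H ->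
  uniq [:: a; b; c; d; x; y] -> ~: cover H \subset [set t] -> t \notin cover H ->
  f \in H -> x \in f -> y \notin f -> #|T| <= #|H| + 3.
Proof.
move=> twab twcd xyH ul iso tH fH xf yf.
have ug : uniq [:: c; d; x; y].
  by move: ul; rewrite /= !inE !negb_or; do ![case: (_ == _) => //].
have ua : uniq [:: a; b; c; d; x].
  by move: ul; rewrite /= !inE !negb_or; do ![case: (_ == _) => //].
have [z [w [uw /and5P[xzH yzH xwH ywH zwH]]]] := clique_half twcd xyH ug tH fH xf yf.
have us : uniq [:: a; b; c; d; x; y; z; w].
  have := twin_outside twab xzH ua; have := twin_outside twab xwH ua.
  by move: ul uw; rewrite /= !inE !negb_or; do ![case: (_ == _) => //].
have uq : uniq [:: a; b; c; d].
  by move: ul; rewrite /= !inE !negb_or; do ![case: (_ == _) => //].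
apply: (@codes_bound a _ [:: [:: 0; 1; 2; 3]; [:: 2; 3; 4; 5]; [:: 2; 3; 4; 6];
    [:: 2; 3; 5; 6]; [:: 2; 3; 4; 7]; [:: 2; 3; 5; 7]; [:: 2; 3; 6; 7]] t a b c d us) => //.
  by rewrite /= /decode /= pair_quad // xyH xzH yzH xwH ywH zwH.
by move=> r; rewrite !inE => /or4P[] ->; rewrite ?orbT.
Qed.

Lemma clique_bound a b c d x y t : twin a b -> twin c d -> quad c d x y \in H ->
  uniq [:: a; b; c; d; x; y] -> ~~ twin x y -> ~: cover H \subset [set t] ->
  t \notin cover H -> #|T| <= #|H| + 3.
Proof.
move=> twab twcd xyH ul ntw iso tH.
have xy : x != y by move: ul; rewrite /= !inE !negb_or; do ![case: (_ == _) => //].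
have [f fH] := not_twin xy ntw; case xf: (x \in f); case yf: (y \in f) => // _.
  by apply: (clique_bound_half twab twcd xyH ul iso tH fH xf); rewrite yf.
apply: (@clique_bound_half a b c d y x t f); rewrite ?xf // -1?quad_swap //.
by move: ul; rewrite /= !inE !negb_or (eq_sym y x); do ![case: (_ == _) => //].
Qed.

(** Blocking [a b c t] yields an edge [quad c d x y] that avoids [a], [b]. If [x], [y] are not
    twins, a 4-clique appears in the link of [c], [d]. If they are twins, blocking [a b c x] yields
    an edge made of either [c], [d] or [x], [y] and a further pair [x1], [y1], which gives a fourth
    twin pair or again a 4-clique. *)
Lemma isolated_bound a b c d t : uniq [:: a; b; c; d] -> twin a b -> twin c d ->
  ~: cover H \subset [set t] -> t \notin cover H -> #|T| <= #|H| + 3.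
Proof.
move=> ul twab twcd iso tH; have abcdH := pair_quad ul twab twcd.
have ne_t s : s \in [:: a; b; c; d] -> s != t.
  by move=> /(quad_cover abcdH) sH; apply: contraTneq sH => ->.
have out f s : f \in H -> s \notin cover H -> (s \in f) = false.
  by move=> fH; apply: contraNF => sf; apply/bigcupP; exists f.
have [||f fH eq1] := @quad_blocked a b c t.
- move: ul (ne_t a) (ne_t b) (ne_t c); rewrite /= !inE !negb_or !eqxx !orbT.
  move=> + /(_ isT) + /(_ isT) + /(_ isT).
  by do ![case: (_ == _) => //].
- by apply: contra tH => qH; apply: (quad_cover qH); rewrite !inE eqxx !orbT.
have [af bf cf] : [/\ a \notin f, b \notin f & c \in f].
  move: eq1; rewrite (out f t) // -(twin_mem twab fH).
  by case: (a \in f); case: (c \in f).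
have df : d \in f by rewrite -(twin_mem twcd fH).
have cd : c != d by case/andP: twcd.
have [x [y [eq_f uf]]] := complete2 (H_card fH) cd cf df.
have u6 : uniq [:: a; b; c; d; x; y].
  move: ul uf af bf; rewrite eq_f /= !inE !negb_or.
  by do ![case: (_ == _) => //].
have xyH : quad c d x y \in H by rewrite -eq_f.
have [twxy|ntw] := boolP (twin x y); last exact: clique_bound twab twcd xyH u6 ntw iso tH.
have uabcx : uniq [:: a; b; c; x].
  by move: u6; rewrite /= !inE !negb_or; do ![case: (_ == _) => //].
have [|g gH eq2] := quad_blocked uabcx.
  apply/negP => qH; have := twin_mem twcd qH; rewrite !inE eqxx !orbT.
  move: u6; rewrite /= !inE !negb_or !(eq_sym d) ; by do ![case: (_ == _) => //].
have ag : a \notin g.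
  by move: eq2; rewrite -(twin_mem twab gH); case: (a \in g); case: (c \in g); case: (x \in g).
have bg : b \notin g by rewrite -(twin_mem twab gH).
have xy : x != y by case/andP: twxy.
have: (c \in g) != (x \in g).
  by move: eq2; rewrite (negbTE ag) (negbTE bg); case: (c \in g); case: (x \in g).
case cg: (c \in g); case xg: (x \in g) => // _.
- have [x1 [y1 [eq_g ug]]] : exists x1 y1, g = quad c d x1 y1 /\ uniq [:: c; d; x1; y1].
    by apply: complete2 => //; [exact: H_card | rewrite -(twin_mem twcd gH)].
  have yg : y \notin g by rewrite -(twin_mem twxy gH) xg.
  have u8 : uniq [:: a; b; c; d; x; y; x1; y1].
    move/negbT: xg; move: u6 ug ag bg yg; rewrite eq_g /= !inE !negb_or.
    by do ![case: (_ == _) => //].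
  have [tw1|ntw1] := boolP (twin x1 y1); first exact: eight_bound u8 twab twcd twxy tw1 iso.
  apply: (clique_bound twab twcd _ _ ntw1 iso tH); first by rewrite -eq_g.
  by move: u8; rewrite /= !inE !negb_or; do ![case: (_ == _) => //].
- have [x1 [y1 [eq_g ug]]] : exists x1 y1, g = quad x y x1 y1 /\ uniq [:: x; y; x1; y1].
    by apply: complete2 => //; [exact: H_card | rewrite -(twin_mem twxy gH)].
  have dg : d \notin g by rewrite -(twin_mem twcd gH) cg.
  have u8 : uniq [:: a; b; c; d; x; y; x1; y1].
    move/negbT: cg; move: u6 ug ag bg dg; rewrite eq_g /= !inE !negb_or.
    by do ![case: (_ == _) => //].
  have [tw1|ntw1] := boolP (twin x1 y1); first exact: eight_bound u8 twab twcd twxy tw1 iso.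
  apply: (clique_bound twab twxy _ _ ntw1 iso tH); first by rewrite -eq_g.
  by move: u8; rewrite /= !inE !negb_or; do ![case: (_ == _) => //].
Qed.

Lemma disjoint_pairs_bound a b c d : uniq [:: a; b; c; d] -> twin a b -> twin c d ->
  #|T| <= #|H| + 3.
Proof.
move=> ul twab twcd; have abcdH := pair_quad ul twab twcd.
have [iso0|[t]] := set_0Vmem (~: cover H).
  apply: (pairs_bound (F0 := [set quad a b c d]) ul twab twcd); first by rewrite sub1set.
  by rewrite iso0 setU0 /cover big_set1 setUid cards1 (card_sets_uniq ul).
rewrite in_setC => tH; apply: (isolated_bound ul twab twcd _ tH).
(* Two isolated vertices would be twins, and together with [a], [b] would form an edge. *)
apply/subsetP => s; rewrite in_setC in_set1 => sH; apply: contraT => st.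
have ne_l r : r \in [:: a; b; c; d] -> (r != s) && (r != t).
  by move=> /(quad_cover abcdH) rH; apply/andP; split; apply: contraTneq rH => ->.
have uq : uniq [:: a; b; s; t].
  move: ul (ne_l a) (ne_l b) st; rewrite /= !inE !negb_or !eqxx !orbT.
  move=> + /(_ isT) + /(_ isT).
  by do ![case: (_ == _) => //].
have qH := pair_quad uq twab (isolated_twin sH tH st).
by case/negP: sH; apply: (quad_cover qH); rewrite !inE eqxx !orbT.
Qed.

Lemma twin_trans p q r : p != r -> twin p q -> twin q r -> twin p r.
Proof.
move=> pr tw1 tw2; rewrite /twin pr; apply/forall_inP => f fH.
by rewrite (twin_mem tw1 fH) (twin_mem tw2 fH).
Qed.

(** Without disjoint twin pairs, all vertices that have a twin are twins of each other. Four
    elements of [Z] would include at least three such vertices, and then four, which split into two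
    disjoint pairs; hence [Z] has at most three elements. *)
Lemma saturated_bound : #|T| <= #|H| + 3.
Proof.
have [/existsP[a /existsP[b /existsP[c /existsP[d]]]]|none] :=
    boolP [exists a, exists b, exists c, exists d, [&& uniq [:: a; b; c; d], twin a b & twin c d]].
  by case/and3P; apply: disjoint_pairs_bound.
have meet_pairs a b c d : twin a b -> twin c d -> ~~ uniq [:: a; b; c; d].
  move=> twab twcd; apply: contra none => ul; apply/existsP; exists a.
  by apply/existsP; exists b; apply/existsP; exists c; apply/existsP; exists d; rewrite ul twab twcd.
pose Z := [set u | (u \notin cover H) || [exists v, twin u v]].
apply: (@twin_kernel_bound Z set0); rewrite ?sub0set //; last first.
  rewrite cards0 add0n /cover big_set0 setU0 leqNgt; apply/negP => Z3.
  pose tw s := [exists v, twin s v].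
  have twin_tw r s : r != s -> tw r -> tw s -> twin r s.
    move=> rs /existsP[r' twr] /existsP[s' tws]; have := meet_pairs _ _ _ _ twr tws.
    have [[rr' _] [ss' _]] := (andP twr, andP tws).
    rewrite /= !inE (negbTE rr') (negbTE rs) (negbTE ss') /=.
    case: (r =P s') => [->|_]; first by rewrite twin_sym.
    case: (r' =P s) => [<-//|_].
    case: (r' =P s') => [eq_r'|//] _; apply: twin_trans rs twr _.
    by rewrite eq_r' twin_sym.
  have isoZ s : s \in Z -> ~~ tw s -> s \notin cover H.
    by rewrite inE => /orP[//|sw]; rewrite /tw sw.
  have one_tw r s : r != s -> r \in Z -> s \in Z -> tw r || tw s.
    move=> rs rZ sZ; apply: contraT; rewrite negb_or => /andP[ntr nts].
    case/negP: (ntr); apply/existsP; exists s.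
    exact: isolated_twin (isoZ _ rZ ntr) (isoZ _ sZ nts) rs.
  (* An edge meets three mutual twins and an isolated vertex in 0 or 3 vertices, so these four would
     form an edge. *)
  have three_tw a b c d : uniq [:: a; b; c; d] -> tw a -> tw b -> tw c -> d \in Z -> tw d.
    move=> ul twa twb twc dZ; apply: contraT => /(isoZ _ dZ) dH.
    have [ab ac] : a != b /\ a != c.
      by move: ul; rewrite /= !inE !negb_or; do ![case: (_ == _) => //].
    have qH : quad a b c d \in H.
      apply: quad_in => // f fH.
      rewrite -(twin_mem (twin_tw _ _ ab twa twb) fH) -(twin_mem (twin_tw _ _ ac twa twc) fH).
      have -> : (d \in f) = false by apply: contraNF dH => df; apply/bigcupP; exists f.
      by case: (a \in f).
    by case/negP: dH; apply: (quad_cover qH); rewrite !inE eqxx !orbT.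
  have [a [b [c [d [ul [aZ bZ cZ dZ]]]]]] : exists a b c d, uniq [:: a; b; c; d] /\
      [/\ a \in Z, b \in Z, c \in Z & d \in Z].
    have := enum_uniq Z; have := mem_enum Z; move: Z3; rewrite cardE.
    case: (enum Z) => [|a [|b [|c [|d l]]]] // _ memZ ul; exists a, b, c, d.
    rewrite -!memZ !in_cons !eqxx !orbT; split=> //.
    by move: ul; rewrite -[_ :: _]/([:: a; b; c; d] ++ l) cat_uniq => /andP[].
  have [ab ac ad bc [bd cd]] : [/\ a != b, a != c, a != d, b != c & b != d /\ c != d].
    by move: ul; rewrite /= !inE !negb_or; do ![case: (_ == _) => //].
  have [twa twb twc twd] : [/\ tw a, tw b, tw c & tw d].
    move: (one_tw _ _ ab aZ bZ) (one_tw _ _ ac aZ cZ) (one_tw _ _ ad aZ dZ).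
    move: (one_tw _ _ bc bZ cZ) (one_tw _ _ bd bZ dZ) (one_tw _ _ cd cZ dZ).
    have [ua [ub uc]] : uniq [:: b; c; d; a] /\ uniq [:: a; c; d; b] /\ uniq [:: a; b; d; c].
      move: ul; rewrite /= !inE !negb_or (eq_sym b a) (eq_sym c a) (eq_sym d a).
      rewrite (eq_sym c b) (eq_sym d b) (eq_sym d c).
      by do ![case: (_ == _) => //].
    move: (three_tw _ _ _ _ ul) (three_tw _ _ _ _ ua) (three_tw _ _ _ _ ub) (three_tw _ _ _ _ uc).
    rewrite aZ bZ cZ dZ.
    case: (tw a); case: (tw b); case: (tw c); case: (tw d) => // h1 h2 h3 h4.
    - by have := h1 isT isT isT isT.
    - by have := h4 isT isT isT isT.
    - by have := h3 isT isT isT isT.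
    - by have := h2 isT isT isT isT.
  by have := meet_pairs _ _ _ _ (twin_tw _ _ ab twa twb) (twin_tw _ _ cd twc twd); rewrite ul.
split.
- move=> p; rewrite inE => /orP[/negP//|/existsP[q tw] _]; exists q => //.
  by rewrite inE; apply/orP; right; apply/existsP; exists p; rewrite twin_sym.
- by move=> p q _ tw; rewrite inE; apply/orP; right; apply/existsP; exists p; rewrite twin_sym.
- by left=> p q tw; rewrite inE; apply/orP; right; apply/existsP; exists q.
by apply/subsetP => p; rewrite !inE => ->.
Qed.

End Saturated.

(** * The cases n = 7 and n = 8 *)

(* Depth-first searches over the hypergraphs on 7 and 8 vertices; every branch
   reaches 7, respectively 8, edges. *)
Definition seven_cert : seq cert_node := [::
  (7, [:: [:: 2; 3; 4; 5]; [:: 2; 3; 4; 6]; [:: 2; 3; 5; 6]; [:: 1; 4; 5; 6];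
  [:: 2; 4; 5; 6]; [:: 3; 4; 5; 6]], Sat [:: 1; 2; 4; 5], [::]);
  (7, [:: [:: 2; 3; 4; 5]; [:: 2; 3; 4; 6]; [:: 2; 3; 5; 6]; [:: 2; 4; 5; 6];
  [:: 3; 4; 5; 6]], Sat [:: 0; 2; 3; 4], [:: (0, [:: 1; 0; 5; 6; 2; 3; 4]);
  (0, [:: 0; 1; 3; 4; 2; 5; 6]); (0, [:: 0; 1; 2; 4; 3; 5; 6]); (0, [:: 0; 1;
  2; 3; 4; 5; 6])]);
  (7, [:: [:: 2; 3; 4; 6]; [:: 2; 3; 5; 6]; [:: 2; 4; 5; 6]; [:: 3; 4; 5; 6]],
  Sat [:: 2; 3; 4; 5], [:: (1, [:: 0; 1; 2; 3; 4; 5; 6])]);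
  (7, [:: [:: 0; 1; 5; 6]; [:: 0; 3; 5; 6]; [:: 2; 3; 5; 6]; [:: 1; 4; 5; 6];
  [:: 2; 4; 5; 6]; [:: 3; 4; 5; 6]], Sat [:: 0; 2; 5; 6], [::]);
  (7, [:: [:: 2; 3; 4; 6]; [:: 0; 2; 5; 6]; [:: 1; 3; 5; 6]; [:: 1; 4; 5; 6];
  [:: 2; 4; 5; 6]; [:: 3; 4; 5; 6]], Sat [:: 2; 3; 4; 5], [::]);
  (7, [:: [:: 0; 1; 5; 6]; [:: 2; 3; 5; 6]; [:: 1; 4; 5; 6]; [:: 2; 4; 5; 6];
  [:: 3; 4; 5; 6]], Sat [:: 0; 2; 5; 6], [:: (3, [:: 0; 1; 3; 2; 4; 5; 6]);
  (4, [:: 0; 2; 1; 3; 4; 6; 5]); (4, [:: 0; 2; 1; 3; 4; 5; 6])]);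
  (7, [:: [:: 0; 1; 4; 6]; [:: 2; 3; 4; 6]; [:: 0; 2; 5; 6]; [:: 1; 3; 5; 6];
  [:: 2; 4; 5; 6]; [:: 3; 4; 5; 6]], Sat [:: 0; 4; 5; 6], [::]);
  (7, [:: [:: 1; 3; 4; 6]; [:: 0; 1; 5; 6]; [:: 2; 3; 5; 6]; [:: 2; 4; 5; 6];
  [:: 3; 4; 5; 6]], Sat [:: 1; 3; 5; 6], [:: (4, [:: 0; 2; 1; 4; 3; 5; 6]);
  (6, [:: 0; 1; 2; 3; 5; 4; 6])]);
  (7, [:: [:: 0; 1; 5; 6]; [:: 2; 3; 5; 6]; [:: 2; 4; 5; 6]; [:: 3; 4; 5; 6]],
  Sat [:: 0; 2; 5; 6], [:: (5, [:: 1; 0; 3; 4; 2; 5; 6]); (7, [:: 0; 1; 2; 3;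
  4; 6; 5]); (7, [:: 0; 1; 2; 3; 4; 5; 6])]);
  (7, [:: [:: 2; 3; 5; 6]; [:: 2; 4; 5; 6]; [:: 3; 4; 5; 6]], Sat [:: 2; 3; 4;
  5], [:: (2, [:: 0; 1; 2; 3; 4; 6; 5]); (8, [:: 0; 1; 2; 3; 4; 5; 6])]);
  (7, [:: [:: 1; 2; 4; 6]; [:: 0; 3; 4; 6]; [:: 0; 2; 5; 6]; [:: 2; 3; 5; 6];
  [:: 1; 4; 5; 6]; [:: 3; 4; 5; 6]], Sat [:: 0; 2; 4; 6], [::]);
  (7, [:: [:: 0; 1; 2; 6]; [:: 1; 3; 4; 6]; [:: 0; 3; 5; 6]; [:: 2; 3; 5; 6];
  [:: 1; 4; 5; 6]; [:: 2; 4; 5; 6]], Sat [:: 0; 1; 5; 6], [::]);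
  (7, [:: [:: 0; 1; 3; 6]; [:: 2; 3; 4; 6]; [:: 2; 3; 5; 6]; [:: 0; 4; 5; 6];
  [:: 1; 4; 5; 6]], Sat [:: 0; 3; 4; 6], [:: (10, [:: 1; 2; 5; 0; 3; 4; 6]);
  (11, [:: 0; 3; 1; 4; 2; 5; 6])]);
  (7, [:: [:: 2; 3; 4; 6]; [:: 2; 3; 5; 6]; [:: 0; 4; 5; 6]; [:: 1; 4; 5; 6]],
  Sat [:: 2; 4; 5; 6], [:: (9, [:: 0; 1; 3; 4; 5; 2; 6]); (12, [:: 0; 1; 2; 3;
  4; 5; 6])]);
  (7, [:: [:: 0; 1; 5; 6]; [:: 2; 4; 5; 6]; [:: 3; 4; 5; 6]], Sat [:: 2; 3; 5;
  6], [:: (8, [:: 0; 1; 2; 3; 4; 5; 6]); (13, [:: 2; 3; 0; 1; 4; 6; 5]); (13,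
  [:: 2; 3; 0; 1; 4; 5; 6])]);
  (7, [:: [:: 2; 4; 5; 6]; [:: 3; 4; 5; 6]], Sat [:: 2; 3; 4; 5], [:: (9, [::
  0; 1; 2; 3; 6; 4; 5]); (14, [:: 0; 1; 2; 3; 5; 4; 6]); (14, [:: 0; 1; 2; 3;
  4; 5; 6])]);
  (7, [:: [:: 0; 1; 4; 5]; [:: 2; 3; 4; 5]; [:: 0; 2; 4; 6]; [:: 1; 3; 4; 6];
  [:: 1; 2; 5; 6]; [:: 0; 3; 5; 6]], Sat [:: 0; 4; 5; 6], [::]);
  (7, [:: [:: 2; 3; 4; 5]; [:: 0; 2; 3; 6]; [:: 1; 2; 4; 6]; [:: 1; 3; 5; 6];
  [:: 0; 4; 5; 6]], Sat [:: 2; 3; 4; 6], [:: (14, [:: 0; 5; 1; 3; 2; 4; 6]);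
  (16, [:: 0; 1; 3; 4; 2; 5; 6])]);
  (7, [:: [:: 1; 2; 4; 5]; [:: 1; 3; 4; 6]; [:: 2; 3; 5; 6]; [:: 0; 4; 5; 6]],
  Sat [:: 1; 4; 5; 6], [:: (14, [:: 2; 3; 0; 1; 4; 5; 6]); (17, [:: 0; 1; 2;
  3; 5; 6; 4])]);
  (7, [:: [:: 1; 2; 3; 4]; [:: 1; 2; 5; 6]; [:: 3; 4; 5; 6]], Sat [:: 1; 2; 3;
  5], [:: (15, [:: 0; 4; 3; 6; 1; 2; 5]); (18, [:: 0; 2; 3; 5; 1; 4; 6]); (18,
  [:: 0; 1; 3; 5; 2; 4; 6])]);
  (7, [:: [:: 1; 2; 5; 6]; [:: 3; 4; 5; 6]], Sat [:: 1; 2; 3; 4], [:: (19, [::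
  0; 1; 2; 3; 4; 5; 6]); (14, [:: 3; 4; 0; 2; 1; 5; 6]); (14, [:: 3; 4; 0; 1;
  2; 5; 6]); (14, [:: 1; 2; 0; 4; 3; 5; 6]); (14, [:: 1; 2; 0; 3; 4; 5; 6])]);
  (7, [:: [:: 3; 4; 5; 6]], Sat [:: 0; 3; 4; 5], [:: (15, [:: 1; 2; 0; 6; 3;
  4; 5]); (20, [:: 0; 1; 2; 4; 5; 3; 6]); (20, [:: 0; 1; 2; 3; 5; 4; 6]); (20,
  [:: 0; 1; 2; 3; 4; 5; 6])])].

Definition eight_cert : seq cert_node := [::
  (8, [:: [:: 0; 2; 4; 6]; [:: 3; 4; 5; 6]; [:: 1; 3; 5; 7]; [:: 2; 4; 5; 7];
  [:: 2; 3; 6; 7]; [:: 1; 4; 6; 7]; [:: 0; 5; 6; 7]], Sat [:: 0; 3; 4; 7],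
  [::]);
  (8, [:: [:: 0; 1; 5; 6]; [:: 3; 4; 5; 6]; [:: 2; 3; 4; 7]; [:: 0; 4; 5; 7];
  [:: 1; 4; 6; 7]; [:: 2; 5; 6; 7]; [:: 3; 5; 6; 7]], Sat [:: 0; 3; 6; 7],
  [::]);
  (8, [:: [:: 0; 1; 4; 5]; [:: 2; 4; 5; 6]; [:: 3; 4; 5; 7]; [:: 2; 3; 6; 7];
  [:: 0; 4; 6; 7]; [:: 1; 5; 6; 7]], Sat [:: 0; 2; 5; 7], [:: (0, [:: 1; 3; 0;
  2; 4; 6; 5; 7]); (1, [:: 2; 3; 0; 1; 5; 6; 7; 4]); (1, [:: 0; 1; 2; 3; 7; 4;
  5; 6])]);
  (8, [:: [:: 1; 3; 5; 6]; [:: 3; 4; 5; 7]; [:: 2; 3; 6; 7]; [:: 1; 4; 6; 7];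
  [:: 0; 5; 6; 7]; [:: 2; 5; 6; 7]; [:: 4; 5; 6; 7]], Sat [:: 1; 5; 6; 7],
  [::]);
  (8, [:: [:: 0; 2; 5; 6]; [:: 3; 4; 5; 6]; [:: 1; 3; 4; 7]; [:: 2; 3; 5; 7];
  [:: 2; 4; 6; 7]; [:: 1; 5; 6; 7]; [:: 4; 5; 6; 7]], Sat [:: 0; 3; 6; 7],
  [::]);
  (8, [:: [:: 3; 4; 5; 6]; [:: 1; 3; 4; 7]; [:: 2; 3; 5; 7]; [:: 0; 3; 6; 7];
  [:: 2; 4; 6; 7]; [:: 1; 5; 6; 7]; [:: 4; 5; 6; 7]], Sat [:: 0; 4; 5; 7],
  [::]);
  (8, [:: [:: 2; 3; 5; 6]; [:: 3; 4; 5; 7]; [:: 0; 3; 6; 7]; [:: 2; 4; 6; 7];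
  [:: 1; 5; 6; 7]; [:: 4; 5; 6; 7]], Sat [:: 0; 5; 6; 7], [:: (3, [:: 1; 2; 0;
  3; 4; 5; 6; 7]); (4, [:: 0; 1; 3; 2; 4; 6; 7; 5]); (5, [:: 0; 1; 2; 3; 4; 5;
  7; 6])]);
  (8, [:: [:: 2; 4; 5; 6]; [:: 3; 4; 5; 7]; [:: 2; 3; 6; 7]; [:: 0; 4; 6; 7];
  [:: 1; 5; 6; 7]], Sat [:: 0; 1; 4; 5], [:: (2, [:: 0; 1; 2; 3; 4; 5; 6; 7]);
  (6, [:: 1; 0; 3; 5; 2; 4; 7; 6]); (6, [:: 0; 1; 3; 4; 2; 5; 7; 6]); (6, [::
  1; 0; 2; 5; 3; 4; 6; 7]); (6, [:: 0; 1; 2; 4; 3; 5; 6; 7])]);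
  (8, [:: [:: 1; 2; 3; 7]; [:: 1; 4; 5; 7]; [:: 0; 1; 6; 7]; [:: 2; 4; 6; 7];
  [:: 3; 4; 6; 7]; [:: 2; 5; 6; 7]; [:: 3; 5; 6; 7]], Sat [:: 0; 2; 3; 6],
  [::]);
  (8, [:: [:: 1; 3; 4; 7]; [:: 2; 3; 5; 7]; [:: 0; 3; 6; 7]; [:: 2; 4; 6; 7];
  [:: 1; 5; 6; 7]; [:: 4; 5; 6; 7]], Sat [:: 3; 4; 5; 6], [:: (5, [:: 0; 1; 2;
  3; 4; 5; 6; 7]); (8, [:: 0; 3; 1; 4; 2; 5; 6; 7])]);
  (8, [:: [:: 2; 3; 4; 7]; [:: 0; 4; 5; 7]; [:: 1; 4; 6; 7]; [:: 2; 5; 6; 7];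
  [:: 3; 5; 6; 7]], Sat [:: 2; 4; 5; 6], [:: (7, [:: 0; 1; 2; 3; 5; 6; 4; 7]);
  (9, [:: 1; 0; 2; 4; 5; 3; 6; 7]); (9, [:: 0; 1; 2; 4; 6; 3; 5; 7])]);
  (8, [:: [:: 1; 4; 5; 7]; [:: 1; 2; 6; 7]; [:: 3; 4; 6; 7]; [:: 0; 5; 6; 7];
  [:: 2; 5; 6; 7]; [:: 3; 5; 6; 7]; [:: 4; 5; 6; 7]], Sat [:: 1; 5; 6; 7],
  [::]);
  (8, [:: [:: 0; 1; 5; 6]; [:: 2; 3; 4; 7]; [:: 0; 3; 6; 7]; [:: 1; 4; 6; 7];
  [:: 2; 5; 6; 7]; [:: 3; 5; 6; 7]; [:: 4; 5; 6; 7]], Sat [:: 0; 4; 6; 7],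
  [::]);
  (8, [:: [:: 1; 2; 5; 7]; [:: 1; 3; 6; 7]; [:: 2; 4; 6; 7]; [:: 0; 5; 6; 7];
  [:: 3; 5; 6; 7]; [:: 4; 5; 6; 7]], Sat [:: 1; 5; 6; 7], [:: (11, [:: 0; 2;
  4; 3; 1; 5; 6; 7]); (12, [:: 1; 2; 0; 3; 4; 5; 7; 6])]);
  (8, [:: [:: 2; 3; 4; 6]; [:: 0; 1; 5; 7]; [:: 3; 4; 5; 7]; [:: 1; 3; 6; 7];
  [:: 2; 5; 6; 7]; [:: 4; 5; 6; 7]], Sat [:: 0; 3; 5; 6], [:: (1, [:: 0; 1; 2;
  4; 3; 5; 7; 6]); (10, [:: 0; 2; 3; 4; 5; 1; 6; 7])]);
  (8, [:: [:: 2; 3; 5; 7]; [:: 0; 2; 6; 7]; [:: 3; 4; 6; 7]; [:: 1; 5; 6; 7];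
  [:: 4; 5; 6; 7]], Sat [:: 0; 5; 6; 7], [:: (13, [:: 1; 2; 3; 0; 4; 5; 6;
  7]); (9, [:: 0; 1; 3; 2; 4; 5; 6; 7]); (14, [:: 0; 2; 1; 3; 4; 6; 5; 7])]);
  (8, [:: [:: 3; 4; 5; 7]; [:: 0; 3; 6; 7]; [:: 1; 4; 6; 7]; [:: 2; 5; 6; 7]],
  Sat [:: 0; 4; 5; 6], [:: (7, [:: 1; 2; 0; 3; 4; 5; 6; 7]); (10, [:: 0; 2; 1;
  4; 6; 3; 5; 7]); (15, [:: 2; 0; 5; 4; 1; 3; 6; 7]); (10, [:: 0; 1; 2; 5; 6;
  3; 4; 7]); (15, [:: 1; 0; 4; 5; 2; 3; 6; 7])]);
  (8, [:: [:: 1; 2; 6; 7]; [:: 3; 4; 6; 7]; [:: 0; 5; 6; 7]; [:: 1; 5; 6; 7];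
  [:: 2; 5; 6; 7]; [:: 3; 5; 6; 7]; [:: 4; 5; 6; 7]], Sat [:: 1; 3; 6; 7],
  [::]);
  (8, [:: [:: 0; 2; 6; 7]; [:: 3; 4; 6; 7]; [:: 1; 5; 6; 7]; [:: 2; 5; 6; 7];
  [:: 3; 5; 6; 7]; [:: 4; 5; 6; 7]], Sat [:: 0; 5; 6; 7], [:: (17, [:: 1; 0;
  2; 3; 4; 5; 6; 7])]);
  (8, [:: [:: 2; 3; 4; 5]; [:: 0; 1; 6; 7]; [:: 2; 4; 6; 7]; [:: 3; 4; 6; 7];
  [:: 2; 5; 6; 7]; [:: 3; 5; 6; 7]; [:: 4; 5; 6; 7]], Sat [:: 0; 4; 5; 6],
  [::]);
  (8, [:: [:: 2; 3; 4; 5]; [:: 0; 1; 6; 7]; [:: 3; 4; 6; 7]; [:: 2; 5; 6; 7];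
  [:: 3; 5; 6; 7]; [:: 4; 5; 6; 7]], Sat [:: 0; 3; 5; 6], [:: (14, [:: 1; 0;
  2; 3; 4; 7; 5; 6]); (14, [:: 0; 1; 2; 4; 3; 6; 5; 7]); (19, [:: 0; 1; 2; 3;
  4; 5; 6; 7])]);
  (8, [:: [:: 0; 1; 6; 7]; [:: 3; 4; 6; 7]; [:: 2; 5; 6; 7]; [:: 3; 5; 6; 7];
  [:: 4; 5; 6; 7]], Sat [:: 0; 5; 6; 7], [:: (18, [:: 1; 2; 0; 3; 4; 5; 6;
  7]); (20, [:: 0; 1; 2; 3; 4; 5; 6; 7])]);
  (8, [:: [:: 0; 1; 6; 7]; [:: 2; 4; 6; 7]; [:: 3; 5; 6; 7]; [:: 4; 5; 6; 7]],
  Sat [:: 2; 5; 6; 7], [:: (21, [:: 0; 1; 3; 2; 4; 5; 6; 7]); (15, [:: 1; 2;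
  0; 3; 5; 4; 7; 6]); (15, [:: 1; 2; 0; 3; 5; 4; 6; 7]); (15, [:: 0; 2; 1; 3;
  5; 4; 7; 6]); (15, [:: 0; 2; 1; 3; 5; 4; 6; 7])]);
  (8, [:: [:: 0; 1; 6; 7]; [:: 2; 3; 6; 7]; [:: 4; 5; 6; 7]], Sat [:: 0; 2; 4;
  6], [:: (16, [:: 1; 3; 5; 0; 2; 4; 7; 6]); (16, [:: 1; 2; 4; 0; 3; 5; 6;
  7]); (16, [:: 0; 3; 4; 1; 2; 5; 6; 7]); (16, [:: 0; 2; 5; 1; 3; 4; 6; 7]);
  (16, [:: 0; 2; 4; 1; 3; 5; 7; 6]); (22, [:: 4; 5; 0; 2; 1; 3; 6; 7]); (22,
  [:: 2; 3; 0; 4; 1; 5; 6; 7]); (22, [:: 0; 1; 2; 4; 3; 5; 6; 7])]);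
  (8, [:: [:: 3; 4; 5; 6]; [:: 3; 4; 5; 7]; [:: 3; 4; 6; 7]; [:: 1; 5; 6; 7];
  [:: 2; 5; 6; 7]; [:: 3; 5; 6; 7]; [:: 4; 5; 6; 7]], Sat [:: 0; 5; 6; 7],
  [::]);
  (8, [:: [:: 3; 4; 5; 6]; [:: 2; 3; 4; 7]; [:: 3; 4; 5; 7]; [:: 3; 4; 6; 7];
  [:: 2; 5; 6; 7]; [:: 3; 5; 6; 7]; [:: 4; 5; 6; 7]], Sat [:: 2; 3; 5; 7],
  [::]);
  (8, [:: [:: 3; 4; 5; 6]; [:: 3; 4; 5; 7]; [:: 3; 4; 6; 7]; [:: 2; 5; 6; 7];
  [:: 3; 5; 6; 7]; [:: 4; 5; 6; 7]], Sat [:: 0; 5; 6; 7], [:: (24, [:: 1; 0;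
  2; 3; 4; 5; 6; 7]); (25, [:: 0; 1; 2; 3; 4; 6; 7; 5]); (25, [:: 0; 1; 2; 3;
  4; 5; 7; 6]); (25, [:: 0; 1; 2; 3; 4; 5; 6; 7])]);
  (8, [:: [:: 2; 4; 5; 6]; [:: 3; 4; 5; 7]; [:: 3; 4; 6; 7]; [:: 3; 5; 6; 7];
  [:: 4; 5; 6; 7]], Sat [:: 3; 4; 5; 6], [:: (26, [:: 0; 1; 2; 3; 7; 4; 5;
  6])]);
  (8, [:: [:: 1; 4; 5; 6]; [:: 0; 2; 3; 7]; [:: 3; 4; 5; 7]; [:: 2; 4; 6; 7];
  [:: 3; 4; 6; 7]; [:: 2; 5; 6; 7]; [:: 3; 5; 6; 7]], Sat [:: 2; 4; 5; 7],
  [::]);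
  (8, [:: [:: 1; 3; 5; 6]; [:: 0; 2; 4; 7]; [:: 3; 4; 5; 7]; [:: 3; 4; 6; 7];
  [:: 2; 5; 6; 7]; [:: 4; 5; 6; 7]], Sat [:: 0; 4; 5; 6], [:: (16, [:: 1; 0;
  2; 3; 4; 7; 6; 5]); (28, [:: 0; 1; 2; 4; 3; 6; 5; 7]); (28, [:: 0; 1; 2; 4;
  3; 5; 6; 7])]);
  (8, [:: [:: 2; 3; 4; 5]; [:: 0; 1; 6; 7]; [:: 3; 4; 6; 7]; [:: 3; 5; 6; 7];
  [:: 4; 5; 6; 7]], Sat [:: 0; 3; 4; 6], [:: (29, [:: 1; 2; 0; 5; 7; 3; 4;
  6]); (29, [:: 0; 2; 1; 4; 6; 3; 5; 7]); (29, [:: 0; 2; 1; 3; 6; 4; 5; 7]);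
  (20, [:: 0; 1; 2; 3; 4; 5; 6; 7])]);
  (8, [:: [:: 2; 3; 4; 5]; [:: 3; 4; 6; 7]; [:: 3; 5; 6; 7]; [:: 4; 5; 6; 7]],
  Sat [:: 3; 4; 5; 6], [:: (27, [:: 0; 1; 2; 7; 3; 4; 5; 6]); (30, [:: 0; 1;
  2; 3; 4; 5; 6; 7])]);
  (8, [:: [:: 1; 2; 3; 7]; [:: 1; 4; 5; 7]; [:: 3; 4; 5; 7]; [:: 2; 4; 6; 7];
  [:: 3; 4; 6; 7]; [:: 2; 5; 6; 7]; [:: 3; 5; 6; 7]], Sat [:: 2; 4; 5; 7],
  [::]);
  (8, [:: [:: 1; 2; 5; 7]; [:: 3; 4; 5; 7]; [:: 1; 3; 6; 7]; [:: 2; 4; 6; 7];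
  [:: 3; 5; 6; 7]; [:: 4; 5; 6; 7]], Sat [:: 0; 5; 6; 7], [:: (13, [:: 0; 1;
  2; 3; 4; 5; 6; 7]); (32, [:: 0; 2; 1; 5; 4; 6; 3; 7]); (32, [:: 0; 1; 2; 5;
  3; 6; 4; 7])]);
  (8, [:: [:: 2; 4; 5; 7]; [:: 1; 2; 6; 7]; [:: 3; 4; 6; 7]; [:: 3; 5; 6; 7];
  [:: 4; 5; 6; 7]], Sat [:: 2; 4; 5; 6], [:: (31, [:: 0; 3; 1; 2; 6; 7; 4;
  5]); (33, [:: 0; 1; 2; 3; 5; 6; 4; 7]); (33, [:: 0; 1; 2; 3; 4; 6; 5; 7])]);
  (8, [:: [:: 0; 4; 5; 6]; [:: 1; 2; 3; 7]; [:: 2; 4; 5; 7]; [:: 1; 4; 6; 7];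
  [:: 3; 4; 6; 7]; [:: 2; 5; 6; 7]; [:: 3; 5; 6; 7]], Sat [:: 2; 4; 6; 7],
  [::]);
  (8, [:: [:: 0; 3; 4; 6]; [:: 1; 2; 5; 7]; [:: 1; 3; 6; 7]; [:: 2; 4; 6; 7];
  [:: 3; 5; 6; 7]; [:: 4; 5; 6; 7]], Sat [:: 0; 5; 6; 7], [:: (12, [:: 1; 2;
  0; 3; 4; 5; 7; 6]); (35, [:: 0; 2; 1; 5; 4; 3; 6; 7]); (35, [:: 0; 1; 2; 5;
  3; 4; 6; 7])]);
  (8, [:: [:: 0; 1; 5; 6]; [:: 2; 3; 4; 7]; [:: 1; 2; 6; 7]; [:: 3; 5; 6; 7];
  [:: 4; 5; 6; 7]], Sat [:: 0; 2; 5; 7], [:: (10, [:: 0; 1; 3; 4; 2; 5; 6;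
  7]); (36, [:: 0; 2; 4; 1; 5; 3; 6; 7]); (36, [:: 0; 2; 3; 1; 5; 4; 6; 7])]);
  (8, [:: [:: 1; 2; 4; 7]; [:: 1; 3; 5; 7]; [:: 3; 4; 5; 7]; [:: 2; 3; 6; 7];
  [:: 1; 4; 6; 7]; [:: 2; 5; 6; 7]; [:: 4; 5; 6; 7]], Sat [:: 1; 2; 5; 7],
  [::]);
  (8, [:: [:: 1; 2; 3; 7]; [:: 1; 2; 4; 7]; [:: 3; 4; 5; 7]; [:: 3; 4; 6; 7];
  [:: 1; 5; 6; 7]; [:: 2; 5; 6; 7]], Sat [:: 1; 3; 5; 7], [:: (38, [:: 0; 2;
  4; 6; 1; 5; 3; 7]); (38, [:: 0; 1; 3; 5; 2; 6; 4; 7])]);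
  (8, [:: [:: 1; 2; 4; 7]; [:: 3; 4; 5; 7]; [:: 3; 4; 6; 7]; [:: 1; 5; 6; 7];
  [:: 2; 5; 6; 7]], Sat [:: 4; 5; 6; 7], [:: (34, [:: 0; 2; 1; 3; 5; 6; 4;
  7]); (39, [:: 0; 1; 2; 3; 4; 5; 6; 7])]);
  (8, [:: [:: 2; 3; 4; 7]; [:: 1; 2; 6; 7]; [:: 3; 5; 6; 7]; [:: 4; 5; 6; 7]],
  Sat [:: 3; 4; 6; 7], [:: (34, [:: 0; 1; 2; 5; 3; 4; 6; 7]); (37, [:: 0; 1;
  2; 3; 4; 5; 6; 7]); (10, [:: 0; 1; 3; 4; 2; 5; 6; 7]); (40, [:: 0; 3; 4; 1;
  2; 5; 6; 7])]);
  (8, [:: [:: 2; 3; 4; 7]; [:: 3; 5; 6; 7]; [:: 4; 5; 6; 7]], Sat [:: 3; 4; 5;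
  6], [:: (31, [:: 0; 1; 2; 3; 4; 7; 5; 6]); (41, [:: 1; 0; 2; 3; 4; 6; 5;
  7]); (41, [:: 1; 0; 2; 3; 4; 5; 6; 7]); (41, [:: 0; 1; 2; 3; 4; 6; 5; 7]);
  (41, [:: 0; 1; 2; 3; 4; 5; 6; 7])]);
  (8, [:: [:: 2; 3; 6; 7]; [:: 4; 5; 6; 7]], Sat [:: 0; 1; 6; 7], [:: (23, [::
  0; 1; 2; 3; 4; 5; 6; 7]); (42, [:: 0; 1; 5; 4; 7; 2; 3; 6]); (42, [:: 0; 1;
  5; 4; 6; 2; 3; 7]); (42, [:: 0; 1; 4; 5; 7; 2; 3; 6]); (42, [:: 0; 1; 4; 5;
  6; 2; 3; 7]); (42, [:: 0; 1; 3; 2; 7; 4; 5; 6]); (42, [:: 0; 1; 3; 2; 6; 4;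
  5; 7]); (42, [:: 0; 1; 2; 3; 7; 4; 5; 6]); (42, [:: 0; 1; 2; 3; 6; 4; 5;
  7])]);
  (8, [:: [:: 0; 5; 6; 7]; [:: 1; 5; 6; 7]; [:: 2; 5; 6; 7]; [:: 3; 5; 6; 7];
  [:: 4; 5; 6; 7]], Sat [:: 0; 1; 5; 6], [:: (43, [:: 3; 4; 0; 1; 2; 7; 5;
  6]); (43, [:: 1; 4; 0; 6; 2; 3; 5; 7]); (43, [:: 1; 4; 0; 5; 2; 3; 6; 7]);
  (43, [:: 1; 3; 0; 6; 2; 4; 5; 7]); (43, [:: 1; 3; 0; 5; 2; 4; 6; 7]); (43,
  [:: 1; 2; 0; 6; 3; 4; 5; 7]); (43, [:: 1; 2; 0; 5; 3; 4; 6; 7])]);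
  (8, [:: [:: 1; 5; 6; 7]; [:: 2; 5; 6; 7]; [:: 3; 5; 6; 7]; [:: 4; 5; 6; 7]],
  Sat [:: 0; 5; 6; 7], [:: (44, [:: 0; 1; 2; 3; 4; 5; 6; 7])]);
  (8, [:: [:: 2; 5; 6; 7]; [:: 3; 5; 6; 7]; [:: 4; 5; 6; 7]], Sat [:: 0; 5; 6;
  7], [:: (45, [:: 1; 0; 2; 3; 4; 5; 6; 7]); (42, [:: 0; 1; 2; 3; 4; 6; 7;
  5]); (42, [:: 0; 1; 2; 3; 4; 5; 7; 6]); (42, [:: 0; 1; 2; 3; 4; 5; 6; 7])]);
  (8, [:: [:: 3; 5; 6; 7]; [:: 4; 5; 6; 7]], Sat [:: 0; 5; 6; 7], [:: (46, [::
  1; 2; 0; 3; 4; 5; 6; 7]); (42, [:: 0; 2; 1; 3; 4; 6; 7; 5]); (42, [:: 0; 2;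
  1; 3; 4; 5; 7; 6]); (42, [:: 0; 2; 1; 3; 4; 5; 6; 7]); (42, [:: 0; 1; 2; 3;
  4; 6; 7; 5]); (42, [:: 0; 1; 2; 3; 4; 5; 7; 6]); (42, [:: 0; 1; 2; 3; 4; 5;
  6; 7])]);
  (8, [:: [:: 4; 5; 6; 7]], Sat [:: 0; 1; 4; 5], [:: (43, [:: 2; 3; 0; 1; 6;
  7; 4; 5]); (43, [:: 1; 3; 0; 2; 4; 5; 6; 7]); (43, [:: 1; 2; 0; 3; 4; 5; 6;
  7]); (43, [:: 0; 3; 1; 2; 4; 5; 6; 7]); (43, [:: 0; 2; 1; 3; 4; 5; 6; 7]);
  (43, [:: 0; 1; 2; 3; 5; 7; 4; 6]); (43, [:: 0; 1; 2; 3; 5; 6; 4; 7]); (43,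
  [:: 0; 1; 2; 3; 4; 7; 5; 6]); (43, [:: 0; 1; 2; 3; 4; 6; 5; 7]); (47, [:: 0;
  1; 3; 2; 5; 4; 6; 7]); (47, [:: 0; 1; 3; 2; 4; 5; 6; 7]); (47, [:: 0; 1; 2;
  3; 5; 4; 6; 7]); (47, [:: 0; 1; 2; 3; 4; 5; 6; 7])])].

Lemma seven_cert_ok : cert_ok (leq^~ 7) false (fun=> 7) [::] seven_cert.
Proof. by vm_compute. Qed.

Lemma eight_cert_ok : cert_ok (leq^~ 8) false (fun=> 8) [::] eight_cert.
Proof. by vm_compute. Qed.

Lemma seven_cert_root : (7, [:: iota 3 4]) \in [seq nd.1.1 | nd <- seven_cert].
Proof. by vm_compute. Qed.

Lemma eight_cert_root : (8, [:: iota 4 4]) \in [seq nd.1.1 | nd <- eight_cert].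
Proof. by vm_compute. Qed.

Lemma B4_saturatedP n (H : {set {set 'I_n}}) :
  reflect [/\ {in H, forall f : {set 'I_n}, #|f| = 4},
              {in H &, forall f g : {set 'I_n}, #|f :&: g| != 1}
            & forall g : {set 'I_n}, #|g| = 4 -> g \notin H ->
                exists2 f, f \in H & #|g :&: f| = 1]
          (B4_saturated H).
Proof.
apply: (iffP and3P) => -[Hu Hf Hs]; split.
- by move=> f fH; apply/eqP; apply: (forall_inP Hu).
- by move=> f g fH gH; apply: (forall_inP (forall_inP Hf f fH)).
- move=> g cg gH; have := forallP Hs g; rewrite cg gH /= => /exists_inP[f fH /eqP eq1].
  by exists f.
- by apply/forall_inP => f /Hu ->.
- by apply/forall_inP => f fH; apply/forall_inP => g gH; apply: Hf.
- apply/forallP => g; apply/implyP => /andP[/eqP cg gH].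
  by have [f fH eq1] := Hs g cg gH; apply/exists_inP; exists f; rewrite ?eq1.
Qed.

(** All [n] vertices are known from the start, so the bound on vertices excludes new ones and each
    branch adds an edge on the known vertices. Closed states have at least [n] distinct edges. *)
Lemma cert_bound n (H : {set {set 'I_n}}) cert :
  cert_ok (leq^~ n) false (fun=> n) [::] cert ->
  (n, [:: iota (n - 4) 4]) \in [seq nd.1.1 | nd <- cert] ->
  4 <= n -> B4_saturated H -> n <= #|H|.
Proof.
move=> ok root n4 /B4_saturatedP[Hcard Hfree Hsat].
have [H0|[e eH]] := set_0Vmem H.
  pose g := [set:: [seq widen_ord n4 i | i <- enum 'I_4]].
  have ug : uniq [seq widen_ord n4 i | i <- enum 'I_4].
    by rewrite map_inj_uniq ?enum_uniq // => i j [/val_inj].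
  have cg : #|g| = 4 by rewrite card_sets_uniq // size_map size_enum_ord.
  have gH : g \notin H by rewrite H0 inE.
  by have [f] := Hsat g cg gH; rewrite H0 inE.
have [x0 _] : exists x0, x0 \in e by apply/set0Pn; rewrite -card_gt0 Hcard.
(* [e] is listed last so that its vertices get the codes [n - 4] to [n - 1] used by the root. *)
pose s := enum (~: e) ++ enum e.
have sz : size s = n.
  by rewrite size_cat -!cardE addnC cardsC card_ord.
have us : uniq s.
  rewrite cat_uniq !enum_uniq andbT /=; apply/hasPn => x.
  by rewrite !mem_enum inE => ->.
have szc : size (enum (~: e)) = n - 4.
  by rewrite -cardE cardsCs setCK card_ord Hcard.
have eq_e : decode x0 s (iota (n - 4) 4) = e.
  apply/setP => x; rewrite inE -[n - 4]addn0 iotaDl -map_comp.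
  rewrite (_ : map _ _ = enum e) ?mem_enum //.
  rewrite -[RHS](mkseq_nth x0) -cardE Hcard //; apply: eq_map => i /=.
  by rewrite nth_cat szc ltnNge leq_addr addKn.
have real : realized x0 H setT s [:: iota (n - 4) 4].
  split=> //; first by move=> x _; rewrite inE.
    apply/andP; split=> //; rewrite sz; apply/and3P; split; rewrite ?iota_uniq ?size_iota //.
    by apply/allP => i; rewrite mem_iota subnK // => /andP[].
  by move=> f; rewrite inE => /eqP->; rewrite eq_e.
apply: (cert_ok_refuted _ _ _ _ _ _ _ _ ok root _ real) => //.
- by move=> g _; apply: Hsat.
- by move=> l ul _; rewrite -[X in _ <= X]card_ord -(card_uniqP ul) max_card.
move=> l F [ul _ codeF FH] /and3P[/= _ leF uF]; apply: leq_trans leF _.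
rewrite -(card_decode_family x0 ul codeF uF); apply: subset_leq_card.
by apply/subsetP => f; rewrite inE => /mapP[c cF ->]; apply: FH.
Qed.

(** * Saturated hypergraphs attaining the bound *)

(** Filtering [iota 0 n] by a predicate gives each vertex set one canonical increasing code, so the
    blocking condition can be checked on such codes alone. *)
Lemma code_saturated n (L : seq (seq nat)) : 0 < n ->
  all (edge_code n) L -> uniq [seq sort leq e | e <- L] ->
  {in L &, forall e f, count (mem e) f != 1} ->
  (forall P : pred nat, let F := [seq i <- iota 0 n | P i] in
     size F = 4 -> F \notin L -> has (fun e => count P e == 1) L) ->
  exists H : {set {set 'I_n}}, B4_saturated H /\ #|H| = size L.
Proof.
move=> n0 /allP codeL uL freeL satL; pose x0 := Ordinal n0; pose s := enum 'I_n.
have us : uniq s := enum_uniq _.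
have sz : size s = n by rewrite size_enum_ord.
have codes : all (edge_code (size s)) L by rewrite sz; apply/allP.
exists [set:: [seq decode x0 s e | e <- L]]; split; last exact: card_decode_family.
have nthE i : i < n -> nth x0 s i = i :> nat by move=> lti; rewrite nth_enum_ord.
have mem_dec e i : edge_code n e -> i < n -> (nth x0 s i \in decode x0 s e) = (i \in e).
  case/and3P=> _ _ /allP lte lti; rewrite inE; apply/mapP/idP => [[j je /(congr1 val)]|ie].
    by have /= ltj := lte j je; rewrite /= !nthE // => ->.
  by exists i.
have meet e (f : {set 'I_n}) : edge_code n e ->
    #|decode x0 s e :&: f| = count (fun i => nth x0 s i \in f) e.
  by move=> code_e; apply: card_decodeI; rewrite ?sz.
apply/B4_saturatedP; split.
- move=> f; rewrite inE => /mapP[e eL ->]; have /and3P[/eqP sze ue lte] := codeL _ eL.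
  by rewrite card_sets_uniq ?size_map // decode_uniq ?sz.
- move=> f g; rewrite !inE => /mapP[e eL ->] /mapP[e' e'L ->].
  rewrite meet ?codeL // (eq_in_count (a2 := mem e')) ?freeL //.
  move=> i ie; rewrite mem_dec ?codeL //.
  by case/and3P: (codeL _ eL) => _ _ /allP /(_ _ ie).
move=> g cg gL; pose F := [seq i <- iota 0 n | nth x0 s i \in g].
have eq_g : decode x0 s F = g.
  apply/setP => x; rewrite inE; apply/mapP/idP => [[i]|xg].
    by rewrite mem_filter => /andP[ig _] ->.
  exists (val x); last by rewrite nth_ord_enum.
  by rewrite mem_filter mem_iota /= ltn_ord nth_ord_enum xg.
have ltF : all (ltn^~ n) F by apply/allP => i; rewrite mem_filter mem_iota => /and3P[].
have uF : uniq F by rewrite filter_uniq ?iota_uniq.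
have szF : size F = 4.
  by rewrite -cg -eq_g card_sets_uniq ?size_map // decode_uniq ?sz.
have [|e eL /eqP eq1] := hasP (satL _ szF _).
  by apply: contra gL => FL; rewrite -eq_g inE map_f.
exists (decode x0 s e); first by rewrite inE map_f.
by rewrite setIC meet ?codeL.
Qed.

Definition saturated_codes n (L : seq (seq nat)) :=
  [&& all (edge_code n) L, uniq [seq sort leq e | e <- L],
      all (fun e => all (fun f => count (mem e) f != 1) L) L
    & all (fun F => [|| size F != 4, F \in L | has (fun e => count (mem F) e == 1) L])
          (bounded_subseqs 4 (iota 0 n))].

Lemma saturated_codesP n L : 0 < n -> saturated_codes n L ->
  exists H : {set {set 'I_n}}, B4_saturated H /\ #|H| = size L.
Proof.
move=> n0 /and4P[codeL uL /allP freeL /allP satL]; apply: code_saturated => //.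
  by move=> e f eL fL; apply: (allP (freeL _ eL)).
move=> P F szF FL; have := satL F; rewrite mem_bounded_subseqs ?filter_subseq ?szF //.
move=> /(_ isT); rewrite eqxx (negbTE FL) /= => /hasP[e eL eq1]; apply/hasP; exists e => //.
rewrite -(eqP eq1); apply/eqP; apply: eq_in_count => i ie.
have /and3P[_ _ /allP /(_ _ ie) /= lti] := allP codeL _ eL.
by rewrite [RHS]mem_filter mem_iota /= add0n lti andbT.
Qed.

(** The complements of the lines of the Fano plane; any two meet in two points. A 4-set that is not
    an edge contains a line, and the complement of that line meets it in one point. *)
Definition fano_codes : seq (seq nat) :=
  [:: [:: 0; 1; 2; 3]; [:: 0; 1; 4; 5]; [:: 2; 3; 4; 5]; [:: 0; 2; 4; 6];
      [:: 1; 3; 4; 6]; [:: 1; 2; 5; 6]; [:: 0; 3; 5; 6]].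

(** Vertices 0 and 1 are twins whose link is the complete graph on 2, 3, 4, 5 together with the
    disjoint pair 6, 7; the 4-set 2, 3, 4, 5 is also an edge. *)
Definition eight_codes : seq (seq nat) :=
  [:: [:: 0; 1; 2; 3]; [:: 0; 1; 2; 4]; [:: 0; 1; 2; 5]; [:: 0; 1; 3; 4]; [:: 0; 1; 3; 5];
      [:: 0; 1; 4; 5]; [:: 2; 3; 4; 5]; [:: 0; 1; 6; 7]].

(** All 4-subsets of a 5-set, and one disjoint edge. *)
Definition nine_codes : seq (seq nat) :=
  [:: [:: 0; 1; 2; 3]; [:: 0; 1; 2; 4]; [:: 0; 1; 3; 4]; [:: 0; 2; 3; 4]; [:: 1; 2; 3; 4];
      [:: 5; 6; 7; 8]].

Definition ten_codes : seq (seq nat) :=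
  [:: [:: 0; 1; 2; 3]; [:: 0; 1; 4; 5]; [:: 0; 1; 4; 6]; [:: 0; 1; 5; 6];
      [:: 2; 3; 7; 8]; [:: 2; 3; 7; 9]; [:: 2; 3; 8; 9]].

Definition star_codes m : seq (seq nat) :=
  ten_codes ++ [seq [:: 4; 5; 6; j] | j <- iota 10 m].

(* [B] is the trace of a 4-set on the vertices below 10.  The 4-set is blocked by
   an edge of [ten_codes], or is an edge, or is blocked by some [4 5 6 j]; in the
   last case it has at most one vertex above 9, hence one of them is left for
   [j]. *)
Definition star_core_ok (B : seq nat) :=
  [|| has (fun e => count (mem B) e == 1) ten_codes, B \in ten_codes, B == [:: 4; 5; 6],
      (size B < 4) && (count (mem B) [:: 4; 5; 6] == 0) | (2 < size B) && (count (mem B) [:: 4; 5; 6] == 1)].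

Lemma star_core : all star_core_ok (bounded_subseqs 4 (iota 0 10)).
Proof. by vm_compute. Qed.

(** For [m = 1] the 4-set [{0, 1, 4, 10}] is neither an edge nor blocked. With two spare vertices,
    one outside such a 4-set gives the blocking edge. *)
Lemma star_saturated m : 1 < m ->
  exists H : {set {set 'I_(10 + m)}}, B4_saturated H /\ #|H| = 7 + m.
Proof.
move=> m1; have -> : 7 + m = size (star_codes m) by rewrite size_cat size_map size_iota.
have mem_star e : e \in star_codes m -> e \in ten_codes \/
    exists2 j, 10 <= j < 10 + m & e = [:: 4; 5; 6; j].
  rewrite mem_cat => /orP[|/mapP[j]]; first by left.
  by rewrite mem_iota => jm ->; right; exists j.
have star_in j : 10 <= j < 10 + m -> [:: 4; 5; 6; j] \in star_codes m.
  by move=> jm; rewrite mem_cat map_f ?orbT // mem_iota.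
have ten_lt e i : e \in ten_codes -> i \in e -> i < 10.
  have /allP : all (all (ltn^~ 10)) ten_codes by [].
  by move=> h /h /allP /[apply].
apply: code_saturated => //.
- rewrite all_cat; apply/andP; split.
    have: all (edge_code 10) ten_codes by [].
    apply: sub_all => e /and3P[sz ue /allP lte]; apply/and3P; split=> //.
    by apply/allP => i /lte /= lti; apply: ltn_addr.
  apply/allP => e /mapP[j]; rewrite mem_iota => /andP[j10 jm] ->.
  by rewrite /edge_code /= !inE jm !negb_or !neq_ltn !(leq_trans _ j10).
- rewrite map_cat cat_uniq -!map_comp; apply/and3P; split=> //.
    apply/hasPn => e /mapP[j]; rewrite mem_iota => /andP[j10 _] ->.
    apply/negP => /mapP[e' e'T] /perm_sortP perm.
    have : j \in e'.
      rewrite -(perm_mem (perm _ _ _)) ?inE ?eqxx ?orbT //;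
        [exact: leq_total|exact: leq_trans|exact: anti_leq].
    by move=> /(ten_lt _ _ e'T); rewrite ltnNge j10.
  rewrite map_inj_in_uniq ?iota_uniq // => i j; rewrite !mem_iota => /andP[i10 _] /andP[j10 _].
  move=> /perm_sortP perm; have : i \in [:: 4; 5; 6; j].
    rewrite -(perm_mem (perm _ _ _)) ?inE ?eqxx ?orbT //;
        [exact: leq_total|exact: leq_trans|exact: anti_leq].
  rewrite !inE => /or4P[] /eqP // eq_i; move: i10; by rewrite eq_i.
- move=> e f /mem_star[eT|[i /andP[i10 _] ->]] /mem_star[fT|[j /andP[j10 _] ->]].
  + by have /allP/(_ _ eT)/allP/(_ _ fT) : all (fun e => all (fun f => count (mem e) f != 1) ten_codes) ten_codes by [].
  + have je : (j \in e) = false.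
      by apply/negP => /(ten_lt _ _ eT); rewrite ltnNge j10.
    rewrite /= je.
    by have /allP/(_ _ eT) : all (fun e => (4 \in e) + ((5 \in e) + ((6 \in e) + 0)) != 1) ten_codes by [].
  + have -> : count (mem [:: 4; 5; 6; i]) f = count (mem [:: 4; 5; 6]) f.
      apply: eq_in_count => k /(ten_lt _ _ fT) k10 /=; rewrite !inE.
      by rewrite (ltn_eqF (leq_trans k10 i10)) orbF.
    by have /allP/(_ _ fT) : all (fun f => count (mem [:: 4; 5; 6]) f != 1) ten_codes by [].
  + by [].
move=> P F szF FL.
pose B := [seq i <- iota 0 10 | P i]; pose S := [seq i <- iota 10 m | P i].
have FE : F = B ++ S by rewrite /F iotaD filter_cat.
have szBS : size B + size S = 4 by rewrite -szF FE size_cat.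
have cB e : (forall i, i \in e -> i < 10) -> count P e = count (mem B) e.
  move=> lte; apply: eq_in_count => i /lte i10.
  by rewrite [RHS]mem_filter mem_iota /= add0n i10 andbT.
have cstar j : count P [:: 4; 5; 6; j] = count (mem B) [:: 4; 5; 6] + P j.
  by rewrite -cB //= ?addn0 -?addnA // => i; rewrite !inE => /or3P[] /eqP->.
have szB4 : size B <= 4 by rewrite -szBS leq_addr.
have /or4P := allP star_core B (mem_bounded_subseqs (filter_subseq _ _) szB4).
case=> [/hasP[e eT eq1]|BT|/eqP BT|/orP[]/andP[szB eqT]].
- apply/hasP; exists e; first by rewrite mem_cat eT.
  by rewrite (cB e) // => i; apply: ten_lt.
- have S0 : S = [::].
    have : all (fun e => size e == 4) ten_codes by [].
    by move/allP/(_ _ BT)/eqP => szB; apply: size0nil; move: szBS; rewrite szB => -[].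
  by case/negP: FL; rewrite FE S0 cats0 mem_cat BT.
- have [j SE] : exists j, S = [:: j].
    by move: szBS; rewrite BT; case: (S) => [|j [|? ?]] //; exists j.
  case/negP: FL; rewrite FE BT SE; apply: star_in.
  have : j \in S by rewrite SE inE.
  by rewrite mem_filter mem_iota => /andP[].
- have [j jS] : exists j, j \in S.
    move: szBS szB; case: (S) => [|j l]; last by exists j; rewrite inE eqxx.
    by rewrite addn0 => ->.
  move: jS; rewrite mem_filter mem_iota => /andP[Pj jm].
  by apply/hasP; exists [:: 4; 5; 6; j]; rewrite ?star_in // cstar (eqP eqT) Pj.
have [j jm Pj] : exists2 j, 10 <= j < 10 + m & ~~ P j.
  have: ~~ all P (iota 10 m).
    rewrite all_count -size_filter size_iota -/S; apply/eqP => szS.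
    by move: szBS szB; rewrite szS; move: m1; clear; lia.
  by move=> /allPn[j]; rewrite mem_iota; exists j.
by apply/hasP; exists [:: 4; 5; 6; j]; rewrite ?star_in // cstar (eqP eqT) (negbTE Pj).
Qed.

(** * At most six vertices, and the case distinction on [n] *)

(** Two 4-sets among at most six vertices share at least two of them, so no 4-set can be blocked. *)
Lemma small_saturated n (H : {set {set 'I_n}}) : n <= 6 ->
  B4_saturated H = (H == [set e : {set 'I_n} | #|e| == 4]).
Proof.
move=> n6.
have meet (e f : {set 'I_n}) : #|e| = 4 -> #|f| = 4 -> #|e :&: f| != 1.
  move=> ce cf; have := max_card (mem (e :|: f)); rewrite card_ord cardsU ce cf.
  by move: #|_ :&: _| n6; clear; lia.
apply/B4_saturatedP/eqP => [[Hcard _ Hsat]|->]; last first.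
  split=> [f|f g|g cg]; rewrite ?inE; first by move/eqP.
    by move=> /eqP cf /eqP cg; apply: meet.
  by rewrite cg.
apply/setP => e; rewrite inE; apply/idP/eqP => [/Hcard//|ce].
apply: contraT => eH; have [f fH /eqP] := Hsat e ce eH.
by rewrite (negbTE (meet _ _ ce (Hcard f fH))).
Qed.

Theorem theorem2p3 (n : nat) (hn : 0 < n) :
  is_sat4_B4 n (if n <= 6 then 'C(n, 4) else if n <= 8 then n else n - 3).
Proof.
have [n6|n6] := leqP n 6.
  pose K := [set e : {set 'I_n} | #|e| == 4].
  have cK : #|K| = 'C(n, 4) by rewrite card_draws card_ord.
  split; first by exists K; rewrite small_saturated ?eqxx.
  by move=> H; rewrite small_saturated // => /eqP->; rewrite cK.
have [n8|n8] := leqP n 8.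
  have /orP[/eqP->|/eqP->] : (n == 7) || (n == 8) by move: n6 n8; clear; lia.
    split; first exact: (@saturated_codesP 7 fano_codes).
    by move=> H; apply: cert_bound seven_cert_ok seven_cert_root isT.
  split; first exact: (@saturated_codesP 8 eight_codes).
  by move=> H; apply: cert_bound eight_cert_ok eight_cert_root isT.
split; last first.
  move=> H /B4_saturatedP[Hcard Hfree Hsat]; rewrite leq_subLR addnC.
  by have := saturated_bound Hcard Hfree Hsat; rewrite card_ord.
have [n11|n11] := leqP n 11; last first.
  have [m eq_n] : exists m, n = 10 + m by exists (n - 10); move: n11; clear; lia.
  move: n11; rewrite eq_n => n11; rewrite (_ : 10 + m - 3 = 7 + m) //.
  by apply: star_saturated; move: n11; clear; lia.
have /or3P[/eqP->|/eqP->|/eqP->] : [|| n == 9, n == 10 | n == 11] by move: n8 n11; clear; lia.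
- exact: (@saturated_codesP 9 nine_codes).
- exact: (@saturated_codesP 10 ten_codes).
(* For [n = 11], the Fano complements with one disjoint edge give [7 + 1 = 11 - 3] edges. *)
- exact: (@saturated_codesP 11 (rcons fano_codes (iota 7 4))).
Qed.
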